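(* (1) Let $X$ and $Y$ be bounded geometry metric spaces with property A. If there is a $*$-isomorphism $\phi:C^*_s(X)\to C^*_s(Y)$, then $X$ and $Y$ are coarsely equivalent. (2) Let $X$ and $Y$ be bounded geometry metric spaces. If there is a $*$-isomorphism $\phi:\mathbb{C}_s[X]\to\mathbb{C}_s[Y]$, then $X$ and $Y$ are coarsely equivalent.
   Context: A metric space $X$ has bounded geometry if for all $R\ge 0$ there is $N_R\in\mathbb{N}$ such that every ball of radius $R$ in $X$ has at most $N_R$ elements. A (not necessarily continuous) map $f:X\to Y$ of metric spaces is uniformly expansive if for all $R>0$ there is $S>0$ such that $d(x_1,x_2)\le R$ implies $d(f(x_1),f(x_2))\le S$. Two maps $f,g:X\to Y$ are close if there is $C>0$ with $d(f(x),g(x))\le C$ for all $x\in X$. $X$ and $Y$ are coarsely equivalent if there are uniformly expansive maps $f:X\to Y$ and $g:Y\to X$ such that $f\circ g$ and $g\circ f$ are close to the identity maps on $Y$ and $X$ respectively. Stable uniform Roe algebras: let $\mathcal{H}$ be a separable infinite dimensional complex Hilbert space. For a bounded operator $T$ on $l^2(X,\mathcal{H})\cong l^2(X)\otimes\mathcal{H}$ write $T_{xy}$ for its $(x,y)$ matrix coefficient, a bounded operator on $\mathcal{H}$. $T$ has finite propagation if there is $S>0$ such that $T_{xy}=0$ whenever $d(x,y)\ge S$. $\mathbb{C}_s[X]$ is the $*$-algebra of all finite propagation bounded operators $T$ on $l^2(X,\mathcal{H})$ for which there is a finite dimensional subspace $\mathcal{H}_T\subseteq\mathcal{H}$ such that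 $T_{xy}\in\mathcal{B}(\mathcal{H}_T)$ for all $x,y\in X$ (where $\mathcal{B}(\mathcal{H}_T)$ is viewed inside $\mathcal{B}(\mathcal{H})$ as the operators that map $\mathcal{H}_T$ into itself and vanish on its orthogonal complement). $C^*_s(X)$ is its operator norm closure. Property A (Yu): for all $r>0$, $\epsilon>0$ there are finite subsets $A_x\subseteq X\times\mathbb{N}$ $(x\in X)$ with $(x,1)\in A_x$, with $|A_x\,\triangle\, A_{x'}|/|A_x\cap A_{x'}|<\epsilon$ whenever $d(x,x')\le r$, and such that there is $R>0$ with $d(y,z)\le R$ whenever $(y,m),(z,n)\in A_x$ for some $x$. For bounded geometry metric spaces it is known to be equivalent to the metric sparsification property: there is a constant $0<\kappa\le 1$ such that for all $S\ge0$ there is $D\ge0$ such that for every Borel probability measure $\mu$ on $X$ there is a subset $\Omega=\sqcup_{i\in I}\Omega_i\subseteq X$ with $\mu(\Omega)\ge\kappa$, $\mathrm{diam}(\Omega_i)\le D$ for all $i$, and $d(\Omega_i,\Omega_j)>S$ for all $i\ne j$. *)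

(* Defs.v *)
From HB Require Import structures.
From mathcomp Require Import all_boot all_order all_algebra finmap.
From mathcomp Require Import sesquilinear complex ring.
From mathcomp Require Import all_classical all_reals all_analysis.
From mathcomp Require analysis.showcase.summability.

Set Implicit Arguments.
Unset Strict Implicit.
Unset Printing Implicit Defensive.

Import Order.TTheory GRing.Theory Num.Theory.
Import numFieldNormedType.Exports.

Local Open Scope classical_set_scope.
Local Open Scope complex_scope.
Local Open Scope ring_scope.

Section CoarseGeometry.
Variable R : realType.

Definition bounded_geometry (X : metricType R) : Prop :=
  forall r : R, 0 <= r ->
    exists N : nat, forall x : X, ([set y | mdist x y <= r] #<= `I_N)%card.

Definition uniformly_expansive (X Y : metricType R) (f : X -> Y) : Prop :=
  forall r : R, 0 < r -> exists2 s : R, 0 < s &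
    forall x1 x2, mdist x1 x2 <= r -> mdist (f x1) (f x2) <= s.

Definition close (X Y : metricType R) (f g : X -> Y) : Prop :=
  exists2 c : R, 0 < c & forall x, mdist (f x) (g x) <= c.

Definition coarsely_equivalent (X Y : metricType R) : Prop :=
  exists (f : X -> Y) (g : Y -> X),
    [/\ uniformly_expansive f, uniformly_expansive g,
        close (f \o g) id & close (g \o f) id].

(* Since [0^-1 = 0], the nonemptiness of [A x `&` A x'], which is implicit in
   the quotient being defined, has to be required separately. *)
Definition property_A (X : metricType R) : Prop :=
  forall r eps : R, 0 < r -> 0 < eps ->
    exists A : X -> {fset X * nat},
      [/\ forall x, (x, 1%N) \in A x,
          forall x x', mdist x x' <= r ->
            (A x `&` A x')%fset != fset0 /\
            #|` (A x `\` A x') `|` (A x' `\` A x)|%fset%:R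
              / #|` A x `&` A x'|%fset%:R < eps
        & exists2 R0 : R, 0 < R0 &
            forall x y z m n, (y, m) \in A x -> (z, n) \in A x ->
              mdist y z <= R0].

End CoarseGeometry.

Section Hilbert.
Variables (R : realType) (H : normedModType R[i]).

(* The norm of a normed module over [R[i]] takes its values in [R[i]]. *)
Definition rnorm (v : H) : R := complex.Re `|v|.

Lemma rnormE (v : H) : `|v| = (rnorm v)%:C.
Proof.
by rewrite /rnorm; move: (normr_ge0 v); case: `|v| => a b; rewrite lecE /=
  => /andP[/eqP -> _].
Qed.

Lemma rnorm_ge0 (v : H) : 0 <= rnorm v.
Proof. by move: (normr_ge0 v); rewrite rnormE lecR. Qed.

Lemma rnorm0 : rnorm 0 = 0.
Proof. by rewrite /rnorm normr0. Qed.

Lemma rnormD (u v : H) : rnorm (u + v) <= rnorm u + rnorm v.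
Proof. by move: (ler_normD u v); rewrite !rnormE -rmorphD lecR. Qed.

Lemma rnormZ (a : R[i]) (v : H) : rnorm (a *: v) = complex.Re `|a| * rnorm v.
Proof. by rewrite /rnorm normrZ rnormE; case: `|a| => x y /=; rewrite mulr0 subr0. Qed.

(* [dot] is linear in its first and conjugate linear in its second argument.
   A Hilbert space is a Banach space whose norm comes from such a form. *)
Definition norm_of_dot (dot : {dot H for Num.conj}) : Prop :=
  forall v, `|v| ^+ 2 = dot v v.

Definition lin_span (n : nat) (e : 'I_n -> H) : set H :=
  range (fun a : 'I_n -> R[i] => \sum_(k < n) a k *: e k).

Definition finite_dim (V : set H) : Prop :=
  exists (n : nat) (e : 'I_n -> H), V = lin_span e.

Definition separable_space : Prop := exists2 D : set H, countable D & dense D.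

End Hilbert.

Section L2.
Variables (R : realType) (X : choiceType) (H : normedModType R[i]).

Definition sqsum (u : X -> H) : \bar R :=
  \esum_(x in [set: X]) (rnorm (u x) ^+ 2)%:E.

Definition l2_pred : {pred X -> H} := fun u => (sqsum u < +oo)%E.

Record l2 : Type := L2 { l2_fun :> X -> H; l2_funP : l2_fun \in l2_pred }.

HB.instance Definition _ := [isSub for l2_fun].
HB.instance Definition _ := [Choice of l2 by <:].

Lemma l2_submod_closed : submod_closed l2_pred.
Proof.
have sq0 (w : X -> H) x : (0 <= (rnorm (w x) ^+ 2)%:E)%E.
  by rewrite lee_fin sqr_ge0.
split; first by rewrite unfold_in /l2_pred /sqsum esum1 ?ltry// => x _ /=;
  rewrite rnorm0 expr0n.
move=> a u v; rewrite !unfold_in => ufin vfin.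
pose M : R := 2 * complex.Re `|a| ^+ 2 + 2.
have M0 : 0 <= M by rewrite addr_ge0// mulr_ge0// sqr_ge0.
have bnd x : rnorm ((a *: u + v) x) ^+ 2 <=
    M * rnorm (u x) ^+ 2 + M * rnorm (v x) ^+ 2.
  have := rnormD (a *: u x) (v x); rewrite rnormZ.
  have := rnorm_ge0 ((a *: u + v) x).
  change ((a *: u + v) x) with (a *: u x + v x).
  have := rnorm_ge0 (u x); have := rnorm_ge0 (v x); rewrite /M.
  set p := rnorm (u x); set q := rnorm (v x); set t := rnorm _.
  set c := complex.Re _ => q0 p0 t0 tle.
  apply: (@le_trans _ _ ((c * p + q) ^+ 2)).
    by rewrite lerXn2r ?nnegrE// (le_trans t0).
  rewrite -subr_ge0 (_ : _ - _ =
    (c * p - q) ^+ 2 + 2 * p ^+ 2 + 2 * (c * q) ^+ 2); last by ring.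
  by rewrite !addr_ge0 ?sqr_ge0 // mulr_ge0 ?sqr_ge0 ?ler0n.
have scal (w : X -> H) : (sqsum w < +oo)%E ->
    (\esum_(x in [set: X]) (M * rnorm (w x) ^+ 2)%:E < +oo)%E.
  move=> wfin; apply: (@le_lt_trans _ _ (M%:E * sqsum w)%E); last first.
    by rewrite lte_mul_pinfty ?lee_fin.
  apply: ge_ereal_sup => _ /= [F [finF FX] <-].
  rewrite fsbig_finite//= sumEFin -mulr_sumr EFinM lee_wpmul2l ?lee_fin//.
  apply: ereal_sup_ubound; exists F => //.
  by rewrite fsbig_finite//= sumEFin.
apply: (@le_lt_trans _ _ (\esum_(x in [set: X])
    ((M * rnorm (u x) ^+ 2)%:E + (M * rnorm (v x) ^+ 2)%:E))%E).
  by apply: le_esum => x _; rewrite -EFinD lee_fin.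
rewrite esumD => [|x _|x _]; rewrite ?lee_fin ?mulr_ge0 ?rnorm_ge0//.
by rewrite lte_add_pinfty// scal.
Qed.

HB.instance Definition _ :=
  GRing.isSubmodClosed.Build _ _ l2_pred l2_submod_closed.
HB.instance Definition _ := [SubChoice_isSubLmodule of l2 by <:].

Definition l2norm (u : l2) : R := Num.sqrt (fine (sqsum u)).

(* [summability.sum] is the limit along finite subsets of [X]; the series
   converges absolutely by Cauchy-Schwarz. *)
Definition l2dot (dot : {dot H for Num.conj}) (u v : l2) : R[i] :=
  summability.sum (fun x => (dot (u x) (v x) : R[i]^o)).

Definition single_fun (y : X) (v : H) : X -> H :=
  fun x => if x == y then v else 0.

Lemma single_funP (y : X) (v : H) : single_fun y v \in l2_pred.
Proof.
rewrite unfold_in /sqsum (esumID [set y]); last first.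
  by move=> x _; rewrite lee_fin sqr_ge0.
rewrite setTI esum_set1 ?lee_fin ?sqr_ge0// esum1 ?adde0 ?ltry//.
move=> x [_ /= /eqP xy]; by rewrite /single_fun (negbTE xy) rnorm0 expr0n.
Qed.

Definition single (y : X) (v : H) : l2 := L2 (single_funP y v).

Definition opnorm_ub (T : l2 -> l2) : set R :=
  [set c | 0 <= c /\ forall u, l2norm (T u) <= c * l2norm u].

Definition bounded_operator (T : l2 -> l2) : Prop :=
  linear T /\ opnorm_ub T !=set0.

Definition opnorm (T : l2 -> l2) : R := inf (opnorm_ub T).

Definition adjoint_of (dot : {dot H for Num.conj}) (T S : l2 -> l2) : Prop :=
  forall u v, l2dot dot (T u) v = l2dot dot u (S v).

Definition coef (T : l2 -> l2) (x y : X) : H -> H := fun v => T (single y v) x.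

End L2.

Arguments l2 {R} X H.

Section Roe.
Variables (R : realType) (X : metricType R) (H : normedModType R[i]).
Variable dot : {dot H for Num.conj}.
Implicit Types T S : l2 X H -> l2 X H.

Definition finite_propagation T : Prop :=
  exists2 s : R, 0 < s & forall x y, s <= mdist x y -> coef T x y = cst 0.

(* [B(V)] viewed inside [B(H)]. *)
Definition operators_on (V : set H) : set (H -> H) :=
  [set A | (forall v, V v -> V (A v)) /\
           (forall v, (forall w, V w -> dot v w = 0) -> A v = 0)].

Definition Cs_alg : set (l2 X H -> l2 X H) :=
  [set T | [/\ bounded_operator T, finite_propagation T
    & exists2 V : set H, finite_dim V &
        forall x y, operators_on V (coef T x y)]].

Definition Cs_star : set (l2 X H -> l2 X H) :=
  [set T | bounded_operator T /\
    forall eps : R, 0 < eps ->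
      exists2 S, Cs_alg S & opnorm (T \- S) < eps].

End Roe.

Arguments Cs_alg {R} X {H} dot.
Arguments Cs_star {R} X {H} dot.

(* [phi] matters only on [A]; [A] and [B] are meant to be *-algebras of bounded
   operators, so that the adjoint of an element of [A] is again in [A]. *)
Definition star_isomorphism (R : realType) (X Y : choiceType)
    (H : normedModType R[i]) (dot : {dot H for Num.conj})
    (A : set (l2 X H -> l2 X H)) (B : set (l2 Y H -> l2 Y H))
    (phi : (l2 X H -> l2 X H) -> (l2 Y H -> l2 Y H)) : Prop :=
  set_bij A B phi /\
  forall S T, A S -> A T ->
    [/\ phi (S \+ T) = phi S \+ phi T,
        forall a : R[i], phi (a \*: S) = a \*: phi S,
        phi (S \o T) = phi S \o phi T
      & adjoint_of dot S T -> adjoint_of dot (phi S) (phi T)].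

(* Main.v *)
Require Import Defs.
From HB Require Import structures.
From mathcomp Require Import all_boot all_order all_algebra finmap.
From mathcomp Require Import sesquilinear complex ring lra.
From mathcomp Require Import all_classical all_reals all_analysis.
From mathcomp Require analysis.showcase.summability.

Set Implicit Arguments.
Unset Strict Implicit.
Unset Printing Implicit Defensive.

Import Order.TTheory GRing.Theory Num.Theory.
Import numFieldNormedType.Exports.

Local Open Scope classical_set_scope.
Local Open Scope complex_scope.
Local Open Scope ring_scope.

(** The isomorphism [phi] maps a projection of rank one to a minimal projection,
    which is of rank one again ([image_rank1]); so, as in the case of the algebra
    of compact operators, [phi] is the conjugation by a unitary [U], with inverse
    [V] ([isomorphism_spatial]).  Let [h] be a unit vector of [H].  The image
    [U (single x h)] of a basis vector is a unit vector on [Y], and the point is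
    that it has a large coordinate at some [y = f x], with a lower bound [c] that
    does not depend on [x] ([concentration]).

    The main tool is [uniform_propagation].  Let [E] be an operator that maps
    the fibre at [tau x] to the fibre at [x] by a fixed operator of rank one,
    where [tau] moves points by at most [r].  For every subset [M] of [X] the
    restriction [restr M \o E] lies in the algebra of [X], so its image under
    [phi] has finite propagation up to an error [eps].  By the Baire category
    theorem in the compact space of all subsets ([baire_subsets]), this
    propagation is bounded uniformly in [M].

    For the concentration, the image of the projection onto [h] in each fibre
    is close to a space of functions with values in a finite dimensional subspace
    of [H].  Hence there are finitely many unit vectors [a] of [H] such that every
    [U (single x h)] has a fixed share of its norm in the coordinates
    [c_y = dot (U (single x h) y) a] for one of these [a].  Let
    [eta_y = V (single y a)], an orthonormal family on [X].  For any choice of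
    signs, the vector [w], the sum of the [+- c_y *: eta_y], has the norm of
    the family [c_y], which is bounded below.  It is also the value at [single x h]
    of an operator of the algebra of [X] obtained from a block diagonal operator
    on [Y] with signs as entries.  By uniform propagation applied on [Y], the
    vector [w] lies, up to a small error, in the functions on a ball around [x]
    with values in a finite dimensional subspace of [H]: a space whose dimension
    is bounded independently of [x].  There the signs can be chosen greedily
    ([greedy_signs]) so that [w] becomes as small as if the terms were orthogonal,
    that is, at most the supremum of the [|c_y|] times the square root of the
    dimension.  So some [|c_y|] is not small ([large_coordinate]).

    Let [f : X -> Y] and [g : Y -> X] choose points of large coordinates of the
    images under [U] and [V].  Uniform propagation for matrix units
    ([matrix_unit_propagation]) shows that for [x1] and [x2] at bounded distance
    both vectors are concentrated near the same point, so [f] is uniformly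
    expansive; and that [V (single (f x) a)], which has a large coordinate at [x],
    is concentrated near [g (f x)], so [g \o f] is close to the identity.  The
    situation is symmetric in [X] and [Y].

    Both algebras fit into this argument because it uses approximate forms of
    finite propagation and of finite rank only, which pass to the norm
    closure ([roe_like]). *)

(** * Pre-Hilbert spaces over the complex numbers *)

Section Modulus.
Variable R : realType.
Implicit Types z w : R[i].

Definition cmod z : R := complex.Re `|z|.

Lemma cmodE z : `|z| = (cmod z)%:C.
Proof. by rewrite /cmod normc_def. Qed.

Lemma cmod_ge0 z : 0 <= cmod z.
Proof. by rewrite -lecR -cmodE normr_ge0. Qed.

Lemma cmod_sqr z : cmod z ^+ 2 = complex.Re z ^+ 2 + complex.Im z ^+ 2.
Proof. by apply: complexI; rewrite rmorphXn /= -cmodE -add_Re2_Im2. Qed.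

Lemma cmodM z w : cmod (z * w) = cmod z * cmod w.
Proof. by apply: complexI; rewrite rmorphM /= -!cmodE normrM. Qed.

Lemma cmodD z w : cmod (z + w) <= cmod z + cmod w.
Proof. by rewrite -lecR rmorphD /= -!cmodE ler_normD. Qed.

Lemma cmodN z : cmod (- z) = cmod z.
Proof. by rewrite /cmod normrN. Qed.

Lemma cmod0 : cmod 0 = 0. Proof. by rewrite /cmod normr0. Qed.

Lemma cmod1 : cmod 1 = 1. Proof. by rewrite /cmod normr1. Qed.

Lemma cmod_conj z : cmod (conjc z) = cmod z.
Proof. by rewrite /cmod normcJ. Qed.

Lemma cmod_real (r : R) : 0 <= r -> cmod r%:C = r.
Proof. by move=> r0; rewrite /cmod ger0_norm ?lecR. Qed.

Lemma cmod_eq0 z : (cmod z == 0) = (z == 0).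
Proof. by rewrite -(inj_eq (@complexI R)) -cmodE normr_eq0. Qed.

Lemma Re_le_cmod z : complex.Re z <= cmod z.
Proof.
rewrite (le_trans (ler_norm _))// -(@ler_pXn2r _ 2)// ?nnegrE ?cmod_ge0//.
by rewrite real_normK ?num_real// cmod_sqr lerDl sqr_ge0.
Qed.

Lemma ReD z w : complex.Re (z + w) = complex.Re z + complex.Re w.
Proof. by case: z; case: w. Qed.

Lemma ReN z : complex.Re (- z) = - complex.Re z.
Proof. by case: z. Qed.

Lemma Re_conj z : complex.Re (conjc z) = complex.Re z.
Proof. by case: z. Qed.

Lemma mul_conj z : z * conjc z = (cmod z ^+ 2)%:C.
Proof. by rewrite -sqr_normc cmodE rmorphXn. Qed.

Lemma Re_sum I (s : seq I) (F : I -> R[i]) :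
  complex.Re (\sum_(i <- s) F i) = \sum_(i <- s) complex.Re (F i).
Proof. by elim/big_ind2: _ => // z1 x1 z2 x2 <- <-; rewrite ReD. Qed.

End Modulus.

(** A positive semidefinite form together with its seminorm.  The theory
    below serves both the given Hilbert space and the space of square
    summable functions with values in it. *)
Record prehilbert (R : realType) (E : lmodType R[i]) (ip : E -> E -> R[i])
    (nrm : E -> R) : Prop := Prehilbert {
  ipDl : forall u v w, ip (u + v) w = ip u w + ip v w;
  ipZl : forall a u v, ip (a *: u) v = a * ip u v;
  ipC : forall u v, ip v u = conjc (ip u v);
  ipE : forall u, ip u u = (nrm u ^+ 2)%:C;
  nrm_ge0 : forall u, 0 <= nrm u }.

Section PreHilbert.
Variables (R : realType) (E : lmodType R[i]).
Variables (ip : E -> E -> R[i]) (nrm : E -> R).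
Hypothesis hE : prehilbert ip nrm.
Implicit Types u v w : E.

Lemma ip0l v : ip 0 v = 0.
Proof. by rewrite -(scale0r (0 : E)) (ipZl hE) mul0r. Qed.

Lemma ipNl u v : ip (- u) v = - ip u v.
Proof. by rewrite -scaleN1r (ipZl hE) mulN1r. Qed.

Lemma ipBl u v w : ip (u - v) w = ip u w - ip v w.
Proof. by rewrite (ipDl hE) ipNl. Qed.

Lemma ip_suml I (s : seq I) (F : I -> E) v :
  ip (\sum_(i <- s) F i) v = \sum_(i <- s) ip (F i) v.
Proof.
elim: s => [|i s IH]; first by rewrite !big_nil ip0l.
by rewrite !big_cons (ipDl hE) IH.
Qed.

Lemma ip0r v : ip v 0 = 0.
Proof. by rewrite (ipC hE) ip0l rmorph0. Qed.

Lemma ipDr u v w : ip u (v + w) = ip u v + ip u w.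
Proof. by rewrite (ipC hE) (ipDl hE) rmorphD /= -!(ipC hE). Qed.

Lemma ipZr a u v : ip u (a *: v) = conjc a * ip u v.
Proof. by rewrite (ipC hE) (ipZl hE) rmorphM /= -!(ipC hE). Qed.

Lemma ipNr u v : ip u (- v) = - ip u v.
Proof. by rewrite (ipC hE) ipNl rmorphN /= -!(ipC hE). Qed.

Lemma ipBr u v w : ip u (v - w) = ip u v - ip u w.
Proof. by rewrite ipDr ipNr. Qed.

Lemma nrm_sqr u : nrm u ^+ 2 = complex.Re (ip u u).
Proof. by rewrite (ipE hE). Qed.

Lemma nrmD_sqr u v :
  nrm (u + v) ^+ 2 = nrm u ^+ 2 + nrm v ^+ 2 + 2 * complex.Re (ip u v).
Proof.
rewrite !nrm_sqr ipDr !(ipDl hE) !ReD (ipC hE v u) Re_conj; ring.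
Qed.

Lemma nrmZ a u : nrm (a *: u) = cmod a * nrm u.
Proof.
apply/eqP; rewrite -(@eqrXn2 _ 2)// ?mulr_ge0 ?cmod_ge0 ?(nrm_ge0 hE)//.
apply/eqP; apply: complexI; rewrite -(ipE hE) (ipZl hE) ipZr mulrA mul_conj (ipE hE).
by rewrite -rmorphM -exprMn.
Qed.

Lemma nrm0 : nrm 0 = 0.
Proof. by rewrite -(scale0r (0 : E)) nrmZ cmod0 mul0r. Qed.

Lemma nrmN u : nrm (- u) = nrm u.
Proof. by rewrite -scaleN1r nrmZ cmodN cmod1 mul1r. Qed.

(** The square of the norm of [u - (s * ip u v) *: v] is a nonnegative quadratic
    polynomial in the real number [s].  The seminorm of [v] may vanish, in which
    case a large [s] gives the bound. *)
Lemma cauchy_schwarz u v : cmod (ip u v) <= nrm u * nrm v.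
Proof.
have nu := nrm_ge0 hE u; have nv := nrm_ge0 hE v.
set a := ip u v.
have key (s : R) :
    0 <= nrm u ^+ 2 - 2 * s * cmod a ^+ 2 + s ^+ 2 * cmod a ^+ 2 * nrm v ^+ 2.
  have := sqr_ge0 (nrm (u - (s%:C * a) *: v)).
  have cross : complex.Re (ip u (- ((s%:C * a) *: v))) = - (s * cmod a ^+ 2).
    rewrite ipNr ipZr -/a ReN; congr (- _).
    by rewrite cmod_sqr; case: a => x y /=; ring.
  rewrite nrmD_sqr nrmN nrmZ cmodM cross.
  have -> : (cmod s%:C * cmod a * nrm v) ^+ 2 =
     s ^+ 2 * cmod a ^+ 2 * nrm v ^+ 2.
    by rewrite !exprMn (cmod_sqr s%:C) /= expr0n addr0.
  by move=> h; apply: le_trans h _; rewrite le_eqVlt; apply/orP; left;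
    apply/eqP; ring.
rewrite -(@ler_pXn2r _ 2)// ?nnegrE ?mulr_ge0 ?cmod_ge0// exprMn.
have [v0|v0] := eqVneq (nrm v) 0.
  rewrite v0 expr0n mulr0 leNgt; apply/negP => a0.
  have := key ((nrm u ^+ 2 + 1) / (2 * cmod a ^+ 2)).
  rewrite v0 expr0n mulr0 addr0.
  have -> : 2 * ((nrm u ^+ 2 + 1) / (2 * cmod a ^+ 2)) * cmod a ^+ 2
    = nrm u ^+ 2 + 1 by field; rewrite lt0r_neq0// -(ltr_pXn2r (n := 2)) ?nnegrE
      ?cmod_ge0// expr0n.
  by rewrite opprD addrA subrr sub0r oppr_ge0 ler10.
have v2 : 0 < nrm v ^+ 2 by rewrite exprn_gt0// lt_def v0.
have := key (nrm v ^+ 2)^-1.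
have -> : nrm u ^+ 2 - 2 * (nrm v ^+ 2)^-1 * cmod a ^+ 2
   + (nrm v ^+ 2)^-1 ^+ 2 * cmod a ^+ 2 * nrm v ^+ 2
   = nrm u ^+ 2 - cmod a ^+ 2 / nrm v ^+ 2 by field; rewrite v0.
by rewrite subr_ge0 ler_pdivrMr.
Qed.

Lemma nrmD u v : nrm (u + v) <= nrm u + nrm v.
Proof.
rewrite -(@ler_pXn2r _ 2)// ?nnegrE ?addr_ge0 ?(nrm_ge0 hE)//.
have := le_trans (Re_le_cmod _) (cauchy_schwarz u v).
by rewrite nrmD_sqr; nra.
Qed.

Lemma nrmB u v : nrm (u - v) <= nrm u + nrm v.
Proof. by rewrite (le_trans (nrmD _ _))// nrmN. Qed.

(** In the squared norms of [u + v] and of [u - v] the cross terms are opposite,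
    so one of the two signs makes the cross term nonpositive.  Hence the signs
    can be chosen one after the other such that the square of the norm of the
    sum is at most what orthogonality would give. *)
Lemma greedy_signs (I : eqType) (F : I -> E) (s : seq I) : uniq s ->
  exists b : I -> bool,
    nrm (\sum_(i <- s) (-1) ^+ b i *: F i) ^+ 2 <= \sum_(i <- s) nrm (F i) ^+ 2.
Proof.
elim: s => [|i s IH] /=; first by exists xpredT; rewrite !big_nil nrm0 expr0n.
case/andP=> nis /IH [b hb].
set S := \sum_(i <- s) _ in hb.
pose c := 0 < complex.Re (ip (F i) S).
exists (fun j => if j == i then c else b j).
rewrite !big_cons eqxx.
have -> : \sum_(j <- s) (-1) ^+ (if j == i then c else b j) *: F j = S.
  rewrite [LHS]big_seq [RHS]big_seq; apply: eq_bigr => j js.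
  by case: eqP => // ji; rewrite -ji js in nis.
rewrite nrmD_sqr nrmZ (ipZl hE) -addrA lerD//.
  by rewrite /cmod normr_sign mul1r.
rewrite (le_trans _ hb)// gerDl pmulr_rle0//.
rewrite /c; case: ltrP => h; last by rewrite expr0 mul1r.
by rewrite expr1 mulN1r ReN oppr_le0 ltW.
Qed.

End PreHilbert.

(** * Square summable functions as a pre-Hilbert space *)

Section UnconditionalSums.
Variables (R : realType) (X : choiceType).
Implicit Types (f g : X -> R[i]) (F : {fset X}).

(** Convergence along the finite subsets of [X], with real error bounds in place
    of the topology of the complex numbers. *)
Definition has_sum f (L : R[i]) : Prop := forall eps : R, 0 < eps ->
  exists F0, forall F, (F0 `<=` F)%fset -> cmod (\sum_(x <- F) f x - L) <= eps.

Lemma has_sum_uniq f L L' : has_sum f L -> has_sum f L' -> L = L'.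
Proof.
move=> h h'; apply/eqP; rewrite -subr_eq0 -cmod_eq0 eq_le cmod_ge0 andbT.
apply/ler_addgt0Pl => e e0; rewrite addr0.
have [F0 h0] := h _ (divr_gt0 e0 (ltr0Sn R 1)).
have [F1 h1] := h' _ (divr_gt0 e0 (ltr0Sn R 1)).
have /h0 k0 : (F0 `<=` F0 `|` F1)%fset by rewrite fsubsetUl.
have /h1 k1 : (F1 `<=` F0 `|` F1)%fset by rewrite fsubsetUr.
set S := \sum_(x <- _) _ in k0 k1.
rewrite (_ : L - L' = - (S - L) + (S - L')); last by ring.
by rewrite (le_trans (cmodD _ _))// cmodN [leRHS]splitr lerD.
Qed.

Lemma has_sumD f g L L' : has_sum f L -> has_sum g L' ->
  has_sum (fun x => f x + g x) (L + L').
Proof.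
move=> h h' e e0.
have [F0 h0] := h _ (divr_gt0 e0 (ltr0Sn R 1)).
have [F1 h1] := h' _ (divr_gt0 e0 (ltr0Sn R 1)).
exists (F0 `|` F1)%fset => F; rewrite fsubUset => /andP[/h0 k0 /h1 k1].
rewrite big_split /= opprD addrACA.
by rewrite (le_trans (cmodD _ _))// [leRHS]splitr lerD.
Qed.

Lemma has_sumZ f L a : has_sum f L -> has_sum (fun x => a * f x) (a * L).
Proof.
move=> h e e0; have a0 : 0 < cmod a + 1 by rewrite ltr_wpDl ?cmod_ge0.
have [F0 h0] := h _ (divr_gt0 e0 a0); exists F0 => F /h0.
rewrite ler_pdivlMr// -mulr_sumr -mulrBr cmodM => k; apply: le_trans k.
by rewrite mulrC ler_wpM2l ?cmod_ge0 ?lerDl.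
Qed.

Lemma has_sum_conj f L : has_sum f L -> has_sum (fun x => conjc (f x)) (conjc L).
Proof.
move=> h e e0; have [F0 h0] := h _ e0; exists F0 => F /h0.
by rewrite -rmorph_sum -rmorphB /= cmod_conj.
Qed.

Lemma has_sum_supported y f : (forall x, x != y -> f x = 0) -> has_sum f (f y).
Proof.
move=> f0 e e0; exists [fset y]%fset => F; rewrite fsub1set => yF.
rewrite (big_fsetD1 y)//= big_seq big1 ?addr0 ?subrr ?cmod0 ?ltW// => x.
by rewrite in_fsetD1 => /andP[/f0].
Qed.

(** The bridge from the definition of [l2dot], a limit along the filter of
    finite subsets, to [has_sum]. *)
Lemma summability_sumE f L : has_sum f L ->
  summability.sum (fun x => (f x : R[i]^o)) = L.
Proof.
move=> h; have PF := @summability.totally_filter X.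
apply: cvg_lim => //; apply/(@cvgrPdist_le R[i] R[i]^o) => /= e e0.
have [r r0 re] : exists2 r : R, 0 < r & e = r%:C.
  move: e0; rewrite ltcE /= => /andP[/eqP ei er].
  by exists (complex.Re e); rewrite // {1}[e]complexE ei mulr0 addr0.
have [F0 h0] := h r r0; exists F0 => //= F /h0.
rewrite distrC re cmodE lecR.
by rewrite /summability.partial_sum -(big_seq_fsetE _ _ xpredT f).
Qed.

End UnconditionalSums.

Lemma ler_sum_fset (R : realType) (X : choiceType) (f : X -> R)
    (F F' : {fset X}) : (forall x, 0 <= f x) -> (F `<=` F')%fset ->
  \sum_(x <- F) f x <= \sum_(x <- F') f x.
Proof.
move=> f0 FF'; rewrite [leRHS](bigID (fun x => x \in F))/=.
rewrite ler_wpDr ?sumr_ge0// -[leRHS]big_filter le_eqVlt; apply/orP; left; apply/eqP.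
apply: perm_big; apply: uniq_perm; rewrite ?filter_uniq ?fset_uniq// => x.
rewrite mem_filter; case: (boolP (x \in F)) => //= /(fsubsetP FF') ->//.
Qed.

Section L2Hilbert.
Variables (R : realType) (X : choiceType) (H : normedModType R[i]).
Variable dot : {dot H for Num.conj}.
Hypothesis hdot : norm_of_dot dot.
Implicit Types (u v w : l2 X H) (g : X -> H) (F : {fset X}).

Lemma dot_prehilbert : prehilbert dot (@rnorm R H).
Proof.
split; last exact: rnorm_ge0.
- by move=> u v w; rewrite linearDl.
- by move=> a u v; rewrite linearZl_LR.
- by move=> u v; rewrite hermC expr0 mul1r.
- by move=> u; rewrite -hdot rnormE rmorphXn.
Qed.

Lemma sqsum_lb g F : ((\sum_(x <- F) rnorm (g x) ^+ 2)%:E <= sqsum g)%E.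
Proof.
apply: ereal_sup_ubound; exists [set` F]; first by split.
by rewrite fsbig_finite//= set_fsetK sumEFin.
Qed.

Lemma sqsum_ub g (C : R) :
  (forall F, \sum_(x <- F) rnorm (g x) ^+ 2 <= C) -> (sqsum g <= C%:E)%E.
Proof.
move=> h; apply: ge_ereal_sup => _ /= [F [finF FX] <-].
by rewrite fsbig_finite//= sumEFin lee_fin.
Qed.

Lemma l2_bounded g (C : R) :
  (forall F, \sum_(x <- F) rnorm (g x) ^+ 2 <= C) -> g \in @l2_pred R X H.
Proof.
by move=> /sqsum_ub h; rewrite unfold_in (le_lt_trans h) ?ltry.
Qed.

Lemma sqsum_l2norm u : sqsum u = (l2norm u ^+ 2)%:E.
Proof.
have s0 : (0 <= sqsum u)%E by apply: esum_ge0 => x _; rewrite lee_fin sqr_ge0.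
rewrite /l2norm sqr_sqrtr ?fine_ge0// fineK// ge0_fin_numE//.
exact: (l2_funP u).
Qed.

Lemma l2norm_ge0 u : 0 <= l2norm u. Proof. exact: sqrtr_ge0. Qed.

Lemma sum_le_l2norm u F : \sum_(x <- F) rnorm (u x) ^+ 2 <= l2norm u ^+ 2.
Proof. by rewrite -lee_fin -sqsum_l2norm sqsum_lb. Qed.

Lemma l2norm_sqr_le u (C : R) :
  (forall F, \sum_(x <- F) rnorm (u x) ^+ 2 <= C) -> l2norm u ^+ 2 <= C.
Proof. by move=> /sqsum_ub; rewrite sqsum_l2norm lee_fin. Qed.

Lemma l2norm_le u (C : R) : 0 <= C ->
  (forall F, \sum_(x <- F) rnorm (u x) ^+ 2 <= C ^+ 2) -> l2norm u <= C.
Proof.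
by move=> C0 h; rewrite -(@ler_pXn2r _ 2)// ?nnegrE ?l2norm_ge0 ?l2norm_sqr_le.
Qed.

Lemma l2norm_approx u (eps : R) : 0 < eps ->
  exists F0, forall F, (F0 `<=` F)%fset ->
    l2norm u ^+ 2 - eps <= \sum_(x <- F) rnorm (u x) ^+ 2.
Proof.
move=> e0; apply: contrapT => /forallNP h.
suff : l2norm u ^+ 2 <= l2norm u ^+ 2 - eps by lra.
apply: l2norm_sqr_le => F; rewrite leNgt; apply/negP => hF; apply: (h F).
move=> F' FF'; apply/ltW/(lt_le_trans hF).
by apply: ler_sum_fset => // x; exact: sqr_ge0.
Qed.

Lemma has_sum_sqr u :
  has_sum (fun x => (rnorm (u x) ^+ 2)%:C) (l2norm u ^+ 2)%:C.
Proof.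
move=> e e0; have [F0 h] := l2norm_approx u e0; exists F0 => F /h k.
rewrite -rmorph_sum -rmorphB -opprB rmorphN cmodN cmod_real.
  by rewrite lerBlDl -lerBlDr.
by rewrite subr_ge0 sum_le_l2norm.
Qed.

Lemma l2DE u v x : (u + v) x = u x + v x. Proof. by []. Qed.
Lemma l2ZE (a : R[i]) u x : (a *: u) x = a *: u x. Proof. by []. Qed.
Lemma l2BE u v x : (u - v) x = u x - v x. Proof. by []. Qed.

Lemma l2_ext u v : (forall x, u x = v x) -> u = v.
Proof. by move=> h; apply: val_inj; apply/funext. Qed.

Lemma l2_sumE I (s : seq I) (E : I -> l2 X H) x :
  (\sum_(i <- s) E i) x = \sum_(i <- s) E i x.
Proof.
by elim: s => [|i s IH]; rewrite ?big_nil// !big_cons l2DE IH.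
Qed.

(** Polarization reduces the convergence of the series of inner products to
    that of the four norms of [u + i ^ k v]. *)
Lemma has_sum_l2dot u v : has_sum (fun x => dot (u x) (v x)) (l2dot dot u v).
Proof.
suff [L hL] : exists L, has_sum (fun x => dot (u x) (v x)) L.
  by rewrite /l2dot (summability_sumE hL).
have i2 : 'i%C * 'i%C = -1 :> R[i] by rewrite -expr2 sqr_i.
have ci : conjc 'i%C = - 'i%C :> R[i] by rewrite /= ; congr Complex; rewrite oppr0.
have hP := dot_prehilbert.
have polar (a b : H) : dot a b = 4^-1 * ((rnorm (a + b) ^+ 2)%:C
     + (-1) * (rnorm (a + (-1) *: b) ^+ 2)%:C
     + ('i%C * (rnorm (a + 'i%C *: b) ^+ 2)%:C
     + (- 'i%C) * (rnorm (a + (- 'i%C) *: b) ^+ 2)%:C)).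
  rewrite -!(ipE hP) !(ipDl hP) !(ipDr hP) !(ipZl hP) !(ipZr hP).
  rewrite !rmorphN !rmorph1 /= -/(conjc 'i%C) ci.
  set p := dot a a; set q := dot b b; set s := dot a b; set t := dot b a.
  have e4 : 4 != 0 :> R[i] by rewrite pnatr_eq0.
  apply: (mulfI e4); rewrite mulrA mulfV// mul1r.
  transitivity (2 * s - 2 * ('i%C * 'i%C) * s + 2 * t + 2 * ('i%C * 'i%C) * t);
    first by rewrite i2; ring.
  by ring.
exists (4^-1 * ((l2norm (u + v) ^+ 2)%:C
     + (-1) * (l2norm (u + (-1) *: v) ^+ 2)%:C
     + ('i%C * (l2norm (u + 'i%C *: v) ^+ 2)%:C
     + (- 'i%C) * (l2norm (u + (- 'i%C) *: v) ^+ 2)%:C))).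
rewrite (_ : (fun x => _) = fun x => 4^-1 * ((rnorm ((u + v) x) ^+ 2)%:C
     + (-1) * (rnorm ((u + (-1) *: v) x) ^+ 2)%:C
     + ('i%C * (rnorm ((u + 'i%C *: v) x) ^+ 2)%:C
     + (- 'i%C) * (rnorm ((u + (- 'i%C) *: v) x) ^+ 2)%:C))); last first.
  by apply/funext => x; rewrite polar.
by apply: has_sumZ; repeat apply: has_sumD;
  try apply: has_sumZ; apply: has_sum_sqr.
Qed.

Lemma l2_prehilbert : prehilbert (l2dot dot) (@l2norm R X H).
Proof.
have hP := dot_prehilbert.
split; last exact: l2norm_ge0.
- move=> u v w; apply: (has_sum_uniq (has_sum_l2dot _ _)).
  under eq_fun do rewrite l2DE (ipDl hP).
  by apply: has_sumD; apply: has_sum_l2dot.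
- move=> a u v; apply: (has_sum_uniq (has_sum_l2dot _ _)).
  under eq_fun do rewrite l2ZE (ipZl hP).
  by apply: has_sumZ; apply: has_sum_l2dot.
- move=> u v; apply: (has_sum_uniq (has_sum_l2dot _ _)).
  under eq_fun do rewrite (ipC hP).
  by apply: has_sum_conj; apply: has_sum_l2dot.
- move=> u; apply: (has_sum_uniq (has_sum_l2dot _ _)).
  under eq_fun do rewrite (ipE hP).
  exact: has_sum_sqr.
Qed.

Lemma singleE (y x : X) (a : H) : single y a x = if x == y then a else 0.
Proof. by []. Qed.

Lemma l2dot_singler u y (a : H) : l2dot dot u (single y a) = dot (u y) a.
Proof.
apply: (has_sum_uniq (has_sum_l2dot _ _)).
have -> : dot (u y) a = dot (u y) (single y a y) by rewrite singleE eqxx.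
apply: (@has_sum_supported _ _ y (fun x => dot (u x) (single y a x))) => x xy.
by rewrite singleE (negbTE xy) (ip0r dot_prehilbert).
Qed.

Lemma l2dot_singlel u y (a : H) : l2dot dot (single y a) u = dot a (u y).
Proof.
by rewrite (ipC l2_prehilbert) l2dot_singler -(ipC dot_prehilbert).
Qed.

Lemma rnorm_le_l2norm u x : rnorm (u x) <= l2norm u.
Proof.
rewrite -(@ler_pXn2r _ 2)// ?nnegrE ?l2norm_ge0 ?rnorm_ge0//.
by have := sum_le_l2norm u [fset x]%fset; rewrite big_seq_fset1.
Qed.

Lemma l2norm_single (y : X) (a : H) : l2norm (single y a) = rnorm a.
Proof.
apply/eqP; rewrite eq_le; apply/andP; split; last first.
  by have := rnorm_le_l2norm (single y a) y; rewrite singleE eqxx.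
rewrite -(@ler_pXn2r _ 2)// ?nnegrE ?l2norm_ge0 ?rnorm_ge0// -lecR.
by rewrite -(ipE l2_prehilbert) l2dot_singler singleE eqxx (ipE dot_prehilbert).
Qed.

Lemma l2norm_eq0 u : l2norm u = 0 -> u = 0.
Proof.
move=> u0; apply: l2_ext => x; apply/eqP; rewrite -normr_eq0 rnormE.
have := rnorm_le_l2norm u x; rewrite u0 => h.
suff -> : rnorm (u x) = 0 by [].
by apply/eqP; rewrite eq_le h rnorm_ge0.
Qed.

End L2Hilbert.

(** * Orthonormal lists and orthogonal projections *)

Section Orthonormal.
Variables (R : realType) (E : lmodType R[i]).
Variables (ip : E -> E -> R[i]) (nrm : E -> R).
Hypothesis hE : prehilbert ip nrm.
Implicit Types (u v : E) (s t : seq E).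

Definition orthonormal_list s : Prop :=
  uniq s /\ {in s &, forall a b, ip a b = (a == b)%:R}.

Definition orthoproj s v : E := \sum_(a <- s) ip v a *: a.

Lemma projD s u v : orthoproj s (u + v) = orthoproj s u + orthoproj s v.
Proof.
by rewrite /orthoproj -big_split; apply: eq_bigr => a _; rewrite (ipDl hE) scalerDl.
Qed.

Lemma projZ s c v : orthoproj s (c *: v) = c *: orthoproj s v.
Proof.
by rewrite /orthoproj scaler_sumr; apply: eq_bigr => a _; rewrite (ipZl hE) scalerA.
Qed.

Lemma ip_proj s v b : orthonormal_list s -> b \in s -> ip (orthoproj s v) b = ip v b.
Proof.
move=> [us os] bs; rewrite /orthoproj (ip_suml hE) (bigD1_seq b)//= (ipZl hE) (os b b)//.
rewrite eqxx mulr1 big_seq_cond big1 ?addr0// => a /andP[as_ ab].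
by rewrite (ipZl hE) (os a b)// (negbTE ab) mulr0.
Qed.

Lemma ip_sub_proj s u v : orthonormal_list s -> ip (u - orthoproj s u) (orthoproj s v) = 0.
Proof.
move=> hs; rewrite {2}/orthoproj big_seq.
elim/big_rec: _ => [|b w bs IH]; first by rewrite (ip0r hE).
by rewrite (ipDr hE) IH addr0 (ipZr hE) (ipBl hE) ip_proj// subrr mulr0.
Qed.

Lemma pythagoras s v : orthonormal_list s ->
  nrm v ^+ 2 = nrm (orthoproj s v) ^+ 2 + nrm (v - orthoproj s v) ^+ 2.
Proof.
move=> hs; rewrite -[in LHS](subrK (orthoproj s v) v) (nrmD_sqr hE (v - _)).
by rewrite ip_sub_proj//= mulr0 addr0 addrC.
Qed.

Lemma nrm_proj s v : orthonormal_list s ->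
  nrm (orthoproj s v) ^+ 2 = \sum_(a <- s) cmod (ip v a) ^+ 2.
Proof.
move=> hs; rewrite (nrm_sqr hE) {1}/orthoproj (ip_suml hE) Re_sum.
rewrite !big_seq; apply: eq_bigr => a as_.
by rewrite (ipZl hE) (ipC hE (orthoproj s v)) ip_proj// mul_conj.
Qed.

Lemma nrm_proj_le s v : orthonormal_list s -> nrm (orthoproj s v) <= nrm v.
Proof.
move=> hs; rewrite -(@ler_pXn2r _ 2)// ?nnegrE ?(nrm_ge0 hE)//.
by rewrite (pythagoras v hs) lerDl sqr_ge0.
Qed.

Lemma nrm_sub_proj_le s v : orthonormal_list s -> nrm (v - orthoproj s v) <= nrm v.
Proof.
move=> hs; rewrite -(@ler_pXn2r _ 2)// ?nnegrE ?(nrm_ge0 hE)//.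
by rewrite (pythagoras v hs) lerDr sqr_ge0.
Qed.

Lemma proj_in (W : set E) s v : W 0 ->
  (forall c u v, W u -> W v -> W (c *: u + v)) -> {in s, forall a, W a} ->
  W (orthoproj s v).
Proof.
move=> W0 Wlin Ws; rewrite /orthoproj big_seq.
by elim/big_rec: _ => // a w /Ws Wa Ww; apply: Wlin.
Qed.

(** The last clause says that the orthonormal list stays in the linear span of
    [t], without fixing a description of that span. *)
Lemma gram_schmidt t : (forall u, nrm u = 0 -> u = 0) ->
  exists s, [/\ orthonormal_list s, {in t, forall b, orthoproj s b = b} &
    forall W : set E, W 0 -> (forall c u v, W u -> W v -> W (c *: u + v)) ->
      {in t, forall b, W b} -> {in s, forall a, W a}].
Proof.
move=> def; elim: t => [|b t [s [hs IH sW]]]; first by exists [::].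
pose r := b - orthoproj s b.
have [r0|r0] := eqVneq r 0.
  exists s; split=> // [c|W W0 Wlin Wt].
    rewrite inE => /predU1P[->|/IH//].
    by apply/esym/eqP; rewrite -subr_eq0 -/r r0.
  by apply: sW => // u ut; apply: Wt; rewrite inE ut orbT.
have nr : nrm r != 0 by apply: contra_neq r0 => /def.
pose c := (nrm r)^-1%:C *: r.
have os a : a \in s -> ip c a = 0.
  by move=> as_; rewrite (ipZl hE) (ipBl hE) ip_proj// subrr mulr0.
have cc : ip c c = 1.
  rewrite (ipE hE) (nrmZ hE) cmod_real ?invr_ge0 ?(nrm_ge0 hE)// mulVf//.
  by rewrite expr1n.
exists (c :: s); split; last 1 first.
- move=> W W0 Wlin Wt.
  have Ws : {in s, forall a, W a}.
    by apply: sW => // u ut; apply: Wt; rewrite inE ut orbT.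
  move=> a; rewrite inE => /predU1P[->|/Ws//].
  have := Wlin (-1) _ _ (proj_in b W0 Wlin Ws) (Wt b (mem_head b t)).
  rewrite scaleN1r addrC -/r => Wr; rewrite -[c]addr0; exact: Wlin.
- split=> /=.
    rewrite hs.1 andbT; apply/negP => /os; rewrite cc => /eqP.
    by rewrite oner_eq0.
  move=> x y; rewrite !inE.
  case/predU1P => [->|xs] /predU1P[->|ys]; rewrite ?eqxx//.
  - rewrite os//; case: eqP => // cy; move: (os _ ys); rewrite -cy cc => /eqP.
    by rewrite oner_eq0.
  - rewrite (ipC hE) os// rmorph0; case: eqP => // xc; move: (os _ xs).
    by rewrite xc cc => /eqP; rewrite oner_eq0.
  - exact: hs.2.
have pc x : orthoproj (c :: s) x = ip x c *: c + orthoproj s x by rewrite /orthoproj big_cons.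
have sc x : ip (orthoproj s x) c = 0.
  rewrite /orthoproj (ip_suml hE) big_seq big1// => a /os ca.
  by rewrite (ipZl hE) (ipC hE c) ca rmorph0 mulr0.
move=> x; rewrite inE pc => /predU1P[->|/IH xs]; last first.
  by rewrite -{1}xs sc scale0r add0r.
have bE : b = orthoproj s b + r by rewrite /r addrC subrK.
have -> : ip b c *: c = r.
  rewrite {1}bE (ipDl hE) sc add0r /c (ipZr hE) scalerA (ipE hE).
  rewrite (conjc_real (nrm r)^-1) -!rmorphM /= expr2.
  by rewrite -!mulrA mulfV// mulr1 mulVf// scale1r.
by rewrite addrC.
Qed.

End Orthonormal.

(** * Operators on square summable functions *)

Section Operators.
Variables (R : realType) (X : choiceType) (H : normedModType R[i]).
Variable dot : {dot H for Num.conj}.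
Hypothesis hdot : norm_of_dot dot.
Implicit Types (u v w : l2 X H) (g : X -> H) (F : {fset X}) (M : set X).

Let hH := dot_prehilbert hdot.
Let hL := @l2_prehilbert R X H dot hdot.

Lemma rnorm_eq0 (a : H) : rnorm a = 0 -> a = 0.
Proof. by move=> a0; apply/eqP; rewrite -normr_eq0 rnormE a0. Qed.

(** The default value [0] makes operators definable by formulas before the
    square summability of their values is proved. *)
Definition mkl2 g : l2 X H := insubd (0 : l2 X H) g.

Lemma mkl2E g (C : R) x :
  (forall F, \sum_(y <- F) rnorm (g y) ^+ 2 <= C) -> mkl2 g x = g x.
Proof.
by move=> /l2_bounded h; rewrite /mkl2 -[in RHS](insubdK (0 : l2 X H) h).
Qed.

#[global] Opaque mkl2.

Lemma mkl2_le g u x : (forall y, rnorm (g y) <= rnorm (u y)) -> mkl2 g x = g x.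
Proof.
move=> h; apply: (@mkl2E _ (l2norm u ^+ 2)) => F.
apply: le_trans (sum_le_l2norm u F); apply: ler_sum => y _.
by rewrite lerXn2r ?nnegrE ?rnorm_ge0.
Qed.

Lemma l2norm_mono u v : (forall x, rnorm (u x) <= rnorm (v x)) ->
  l2norm u <= l2norm v.
Proof.
move=> h; apply: l2norm_le => [|F]; first exact: l2norm_ge0.
apply: le_trans (sum_le_l2norm v F); apply: ler_sum => y _.
by rewrite lerXn2r ?nnegrE ?rnorm_ge0.
Qed.

Definition restr M u : l2 X H := mkl2 (fun x => if x \in M then u x else 0).

Lemma restrE M u x : restr M u x = if x \in M then u x else 0.
Proof.
rewrite /restr (@mkl2_le _ u)// => y.
by case: ifP => _ //; rewrite rnorm0 rnorm_ge0.
Qed.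

Lemma restrD M u v : restr M (u + v) = restr M u + restr M v.
Proof.
by apply: l2_ext => x; rewrite l2DE !restrE l2DE; case: ifP; rewrite ?addr0.
Qed.

Lemma restrZ M c u : restr M (c *: u) = c *: restr M u.
Proof.
by apply: l2_ext => x; rewrite l2ZE !restrE l2ZE; case: ifP; rewrite ?scaler0.
Qed.

Lemma restrN M u : restr M (- u) = - restr M u.
Proof. by rewrite -scaleN1r restrZ scaleN1r. Qed.

Lemma restrB M u v : restr M (u - v) = restr M u - restr M v.
Proof. by rewrite restrD restrN. Qed.

Lemma restr_le M u : l2norm (restr M u) <= l2norm u.
Proof.
apply: l2norm_mono => x; rewrite restrE.
by case: ifP => _ //; rewrite rnorm0 rnorm_ge0.
Qed.

Lemma restr_mono M M' u : M `<=` M' -> l2norm (restr M u) <= l2norm (restr M' u).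
Proof.
move=> MM'; apply: l2norm_mono => x; rewrite !restrE.
case: (boolP (x \in M)) => [xM|_]; last by rewrite rnorm0 rnorm_ge0.
by rewrite ifT//; apply/mem_set/MM'/set_mem.
Qed.

Lemma restr_split M u : u = restr M u + restr (~` M) u.
Proof.
apply: l2_ext => x; rewrite l2DE !restrE in_setC.
by case: (x \in M); rewrite /= ?addr0 ?add0r.
Qed.

Lemma restr_pythagoras M u :
  l2norm u ^+ 2 = l2norm (restr M u) ^+ 2 + l2norm (restr (~` M) u) ^+ 2.
Proof.
rewrite {1}(restr_split M u) (nrmD_sqr hL).
suff -> : l2dot dot (restr M u) (restr (~` M) u) = 0 by rewrite /= mulr0 addr0.
apply: (has_sum_uniq (has_sum_l2dot hdot _ _)).
rewrite (_ : (fun x => _) = fun=> 0) => [e e0|].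
  by exists fset0 => F _; rewrite big1// subrr cmod0 ltW.
apply/funext => x; rewrite !restrE in_setC.
by case: (x \in M); rewrite /= ?(ip0r hH) ?(ip0l hH).
Qed.

Lemma restr_agree F M M' u : (forall x, x \in F -> (M x <-> M' x)) ->
  l2norm (restr M u - restr M' u) <= l2norm (restr (~` [set` F]) u).
Proof.
move=> ag; apply: l2norm_mono => x; rewrite l2BE !restrE in_setC.
have [xF|xF] := boolP (x \in [set` F]).
  have -> : (x \in M) = (x \in M').
    by apply/idP/idP => /set_mem h; apply/mem_set/(ag x) => //; move/set_mem: xF.
  by rewrite subrr rnorm0.
by case: (x \in M); case: (x \in M');
  rewrite /= ?subrr ?subr0 ?sub0r ?(nrmN hH) ?rnorm0 ?rnorm_ge0.
Qed.

(** Any set is combined from two sets that agree with [M0] on [F] and a subset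
    of [F]; this carries estimates from the sets that agree with [M0] on [F] to
    all sets. *)
Lemma restr_split3 F M M0 u :
  restr M u = restr [set x | if x \in F then M0 x else M x] u
    - restr [set x | (x \in F) && (x \in M0)] u
    + restr [set` [fset x in F | x \in M]%fset] u.
Proof.
apply: l2_ext => x; rewrite l2DE l2BE !restrE.
have -> : (x \in [set x | if x \in F then M0 x else M x]) =
    if x \in F then x \in M0 else x \in M.
  apply/idP/idP => [/set_mem /=|h]; first by case: ifP => _; apply: mem_set.
  by apply/mem_set => /=; move: h; case: ifP => _ /set_mem.
have -> : (x \in [set x | (x \in F) && (x \in M0)]) = (x \in F) && (x \in M0).
  by apply/idP/idP => [/set_mem//|h]; apply/mem_set.
have -> : (x \in [set` [fset x in F | x \in M]%fset]) = (x \in F) && (x \in M).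
  by apply/idP/idP => [/set_mem /=|h]; [|apply/mem_set => /=];
    rewrite !inE.
by case: (x \in F); case: (x \in M); case: (x \in M0);
  rewrite /= ?subrr ?add0r ?addr0 ?subr0.
Qed.

Lemma restr_sub_le M u v :
  l2norm (restr M u) <= l2norm (restr M v) + l2norm (u - v).
Proof.
rewrite -{1}(subrK v u) addrC restrD (le_trans (nrmD hL _ _))//.
by rewrite lerD2l restr_le.
Qed.

Lemma restr_fset F u : restr [set` F] u = \sum_(x <- F) single x (u x).
Proof.
apply: l2_ext => y; rewrite restrE l2_sumE.
case: (boolP (y \in F)) => yF.
  rewrite ifT ?inE// (big_fsetD1 y yF) singleE eqxx big_seq big1 => [|x].
    by rewrite /= addr0.
  by rewrite in_fsetD1 singleE eq_sym => /andP[/negbTE ->].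
rewrite ifF; last by apply/negbTE; rewrite notin_setE/=; apply/negP.
rewrite big_seq big1// => x xF; rewrite singleE; case: eqP => // yx.
by rewrite yx xF in yF.
Qed.

Lemma restr_tail u (eps : R) : 0 < eps ->
  exists F, l2norm (restr (~` [set` F]) u) <= eps.
Proof.
move=> e0; have [F /(_ F (fsubset_refl F)) h] := l2norm_approx u (exprn_gt0 2 e0).
exists F; rewrite -(@ler_pXn2r _ 2)// ?nnegrE ?l2norm_ge0 ?(ltW e0)//.
have := restr_pythagoras [set` F] u.
suff : \sum_(x <- F) rnorm (u x) ^+ 2 <= l2norm (restr [set` F] u) ^+ 2.
  by move: h; lra.
rewrite (le_trans _ (sum_le_l2norm _ F))// le_eqVlt; apply/orP; left; apply/eqP.
by rewrite !big_seq; apply: eq_bigr => x xF; rewrite restrE ifT// inE.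
Qed.

Definition projl2 s u : l2 X H := mkl2 (fun x => orthoproj dot s (u x)).

Lemma projl2E s u x : orthonormal_list dot s -> projl2 s u x = orthoproj dot s (u x).
Proof. by move=> hs; apply: (@mkl2_le _ u) => y; apply: (nrm_proj_le hH). Qed.

Section ProjectionOntoList.
Variable s : seq H.
Hypothesis hs : orthonormal_list dot s.

Lemma projl2D u v : projl2 s (u + v) = projl2 s u + projl2 s v.
Proof. by apply: l2_ext => x; rewrite l2DE !projl2E// (projD hH). Qed.

Lemma projl2Z c u : projl2 s (c *: u) = c *: projl2 s u.
Proof. by apply: l2_ext => x; rewrite l2ZE !projl2E// (projZ hH). Qed.

Lemma sub_projl2_le u : l2norm (u - projl2 s u) <= l2norm u.
Proof.
apply: l2norm_mono => x.
by rewrite l2BE projl2E//; apply: (nrm_sub_proj_le hH).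
Qed.

Lemma sub_projl2D u v :
  (u + v) - projl2 s (u + v) = (u - projl2 s u) + (v - projl2 s v).
Proof. by rewrite projl2D opprD addrACA. Qed.

End ProjectionOntoList.

Lemma restr_fset_sqr F u :
  l2norm (restr [set` F] u) ^+ 2 = \sum_(x <- F) rnorm (u x) ^+ 2.
Proof.
have inF x : x \in F -> restr [set` F] u x = u x.
  by move=> xF; rewrite restrE ifT// inE.
apply/eqP; rewrite eq_le; apply/andP; split; last first.
  rewrite (le_trans _ (sum_le_l2norm _ F))// le_eqVlt; apply/orP; left; apply/eqP.
  by rewrite !big_seq; apply: eq_bigr => x /inF ->.
apply: l2norm_sqr_le => F'.
have sq x : 0 <= rnorm (restr [set` F] u x) ^+ 2 by exact: sqr_ge0.
apply: le_trans (ler_sum_fset sq (fsubsetUr F F')) _.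
rewrite -(big_fset_incl _ (fsubsetUl F F'))/= => [|x _ xF]; last first.
  rewrite restrE ifF ?rnorm0 ?expr0n//.
  by apply/negbTE; rewrite notin_setE/=; apply/negP.
by rewrite big_seq [leRHS]big_seq; apply: ler_sum => x /inF ->.
Qed.

(** For a finite set [M] this splits off from a vector its part in a finite
    dimensional space. *)
Lemma three_parts s M u : orthonormal_list dot s ->
  l2norm u <= l2norm (restr (~` M) u) + l2norm (u - projl2 s u)
    + l2norm (restr M (projl2 s u)).
Proof.
move=> hs; rewrite {1}(restr_split M u) addrC (le_trans (nrmD hL _ _))//.
rewrite -addrA lerD2l addrC.
exact: (le_trans (restr_sub_le M u (projl2 s u)) (lerD (lexx _) (lexx _))).
Qed.

(** A choice of signs is encoded as a difference of two restrictions, to which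
    estimates that are uniform in the set of restriction apply. *)
Definition signed_restr F (b : X -> bool) u : l2 X H :=
  restr [set x | (x \in F) && ~~ b x] u - restr [set x | (x \in F) && b x] u.

Lemma signed_restrE F b u x :
  signed_restr F b u x = if x \in F then (-1) ^+ b x *: u x else 0.
Proof.
rewrite /signed_restr l2BE !restrE.
have -> : (x \in [set x | (x \in F) && ~~ b x]) = (x \in F) && ~~ b x.
  by apply/idP/idP => [/set_mem//|h]; apply/mem_set.
have -> : (x \in [set x | (x \in F) && b x]) = (x \in F) && b x.
  by apply/idP/idP => [/set_mem//|h]; apply/mem_set.
by case: (x \in F); case: (b x) => /=;
  rewrite ?expr0 ?expr1 ?scaleN1r ?scale1r ?subr0 ?sub0r ?oppr0.
Qed.

Lemma signed_restr_sum F b u :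
  signed_restr F b u = \sum_(x <- F) (-1) ^+ b x *: single x (u x).
Proof.
apply: l2_ext => y; rewrite signed_restrE l2_sumE.
case: (boolP (y \in F)) => yF.
  rewrite (big_fsetD1 y yF) l2ZE singleE eqxx big_seq big1 => [|x].
    by rewrite /= addr0.
  by rewrite in_fsetD1 l2ZE singleE eq_sym => /andP[/negbTE -> _]; rewrite scaler0.
rewrite big_seq big1// => x xF; rewrite l2ZE singleE; case: eqP => [yx|_].
  by rewrite yx xF in yF.
by rewrite scaler0.
Qed.

Lemma rnorm_signed_restr F b u x :
  rnorm (signed_restr F b u x) = if x \in F then rnorm (u x) else 0.
Proof.
rewrite signed_restrE; case: ifP => _; last exact: rnorm0.
by rewrite rnormZ normr_sign mul1r.
Qed.

Lemma singleZ (x : X) c (a : H) : single x (c *: a) = c *: single x a.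
Proof.
by apply: l2_ext => y; rewrite l2ZE !singleE; case: ifP; rewrite ?scaler0.
Qed.

Lemma restr_proj_sum s M (I : Type) (r : seq I) (k : I -> R[i]) (E : I -> l2 X H) :
  orthonormal_list dot s ->
  restr M (projl2 s (\sum_(i <- r) k i *: E i)) =
    \sum_(i <- r) k i *: restr M (projl2 s (E i)).
Proof.
move=> hs; elim: r => [|i r IH]; last first.
  by rewrite !big_cons projl2D// restrD IH projl2Z// restrZ.
rewrite !big_nil -(scale0r (0 : l2 X H)) projl2Z// restrZ.
by rewrite !scale0r.
Qed.

Definition rank1 w w' u : l2 X H := l2dot dot u w' *: w.

Lemma rank1_bounded w w' : bounded_operator (rank1 w w').
Proof.
split; first by move=> a u v; rewrite /rank1 (ipDl hL) (ipZl hL) scalerDl scalerA.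
exists (l2norm w * l2norm w'); split; first by rewrite mulr_ge0 ?l2norm_ge0.
move=> u; rewrite /rank1 (nrmZ hL) mulrC -mulrA ler_wpM2l ?l2norm_ge0//.
by rewrite mulrC (cauchy_schwarz hL).
Qed.


Lemma bounded_operator_pos (T : l2 X H -> l2 X H) : bounded_operator T ->
  exists2 C : R, 0 < C & forall u, l2norm (T u) <= C * l2norm u.
Proof.
move=> [_ [C [C0 h]]]; exists (C + 1) => [|u]; first by rewrite ltr_wpDl.
by rewrite (le_trans (h u))// ler_wpM2r ?l2norm_ge0 ?lerDl.
Qed.

End Operators.

(** * Translation operators on spaces of bounded geometry *)

Section Translations.
Variables (R : realType) (X : metricType R) (H : normedModType R[i]).
Variable dot : {dot H for Num.conj}.
Hypothesis hdot : norm_of_dot dot.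
Implicit Types (u v w : l2 X H) (F : {fset X}) (M : set X).

Let hH := dot_prehilbert hdot.

Definition cball (x : X) (r : R) : set X := [set y | mdist x y <= r].

Lemma cball_fset (hX : bounded_geometry X) (r : R) : exists N : nat, forall x,
  exists2 B : {fset X}, [set` B] = cball x r & (#|` B| <= N)%N.
Proof.
have [r0|r0] := leP 0 r; last first.
  exists 0%N => x; exists fset0; last by rewrite cardfs0.
  apply/seteqP; split=> y //=; rewrite /cball /= => h.
  by have := le_lt_trans (le_trans (mdist_ge0 x y) h) r0; rewrite ltxx.
have [N hN] := hX _ r0; exists N => x; exists (fset_set (cball x r)).
  by rewrite fset_setK//; apply/finite_set_leP; exists N; exact: hN.
exact: geq_card_fset_set (hN x).
Qed.

(** The composition with [tau] on functions, tensored with the operator of rank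
    one on [H] that sends [c] to [dot c b *: a].  For [tau = id] it is block
    diagonal; composed with [restr [set x]] it is the matrix unit from the fibre
    at [tau x] to the fibre at [x]. *)
Definition trans (tau : X -> X) (a b : H) u : l2 X H :=
  mkl2 (fun x => dot (u (tau x)) b *: a).

Section OneTranslation.
Hypothesis hX : bounded_geometry X.
Variables (tau : X -> X) (r : R).
Hypothesis htau : forall x, mdist x (tau x) <= r.

(** The fibres of [tau] lie in balls of radius [r], so their size is bounded. *)
Lemma sum_pullback_le : exists N : nat, forall (g : X -> R) F,
  (forall x, 0 <= g x) -> exists G : {fset X},
    \sum_(x <- F) g (tau x) <= N%:R * \sum_(z <- G) g z.
Proof.
have [N hN] := cball_fset hX r; exists N => g F g0.
exists [fset tau x | x in F]%fset.
rewrite (partition_big_imfset _ tau F) mulr_sumr /=.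
apply: ler_sum => z _; have [B hB cB] := hN z.
rewrite (eq_bigr (fun=> g z)); last by move=> x /eqP ->.
rewrite -big_filter big_const_seq count_predT iter_addr_0 -[leLHS]mulr_natl.
rewrite ler_wpM2r// ler_nat (leq_trans _ cB)//.
apply: uniq_leq_size; first by rewrite filter_uniq// fset_uniq.
move=> x; rewrite mem_filter => /andP[/eqP xz _].
have : [set` B] x by rewrite hB /cball /= metric_sym -xz.
by [].
Qed.

Lemma trans_bound (a b : H) : exists2 K : R, 0 <= K & forall (u : l2 X H) F,
  \sum_(x <- F) rnorm (dot (u (tau x)) b *: a) ^+ 2 <= (K * l2norm u) ^+ 2.
Proof.
have [N hN] := sum_pullback_le.
exists (Num.sqrt N%:R * (rnorm a * rnorm b)) => [|u F].
  by rewrite !mulr_ge0 ?rnorm_ge0.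
have [G hG] := hN (fun x => rnorm (u x) ^+ 2) F (fun x => sqr_ge0 _).
rewrite !exprMn sqr_sqrtr//.
apply: (@le_trans _ _ ((rnorm a ^+ 2 * rnorm b ^+ 2) *
    \sum_(x <- F) rnorm (u (tau x)) ^+ 2)); last first.
  rewrite [leRHS](_ : _ = rnorm a ^+ 2 * rnorm b ^+ 2 *
    (N%:R * l2norm u ^+ 2)); last by ring.
  rewrite ler_wpM2l ?mulr_ge0 ?rnorm_ge0//.
  by apply: (le_trans hG); rewrite ler_wpM2l ?sum_le_l2norm.
rewrite mulr_sumr; apply: ler_sum => x _.
rewrite rnormZ -!exprMn lerXn2r ?nnegrE ?mulr_ge0 ?rnorm_ge0 ?cmod_ge0//.
rewrite mulrC -mulrA ler_wpM2l ?rnorm_ge0// mulrC.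
exact: (cauchy_schwarz hH).
Qed.

Lemma transE a b u x : trans tau a b u x = dot (u (tau x)) b *: a.
Proof. by have [K _ h] := trans_bound a b; exact: mkl2E (h u). Qed.

Lemma trans_bounded a b : bounded_operator (trans tau a b).
Proof.
split.
  move=> c u v; apply: l2_ext => x; rewrite l2DE l2ZE !transE l2DE l2ZE.
  by rewrite (ipDl hH) (ipZl hH) scalerDl scalerA.
have [K K0 h] := trans_bound a b; exists K; split=> // u.
apply: l2norm_le => [|F]; first by rewrite mulr_ge0 ?l2norm_ge0.
apply: le_trans (h u F); rewrite le_eqVlt; apply/orP; left; apply/eqP.
by apply: eq_bigr => x _; rewrite transE.
Qed.

End OneTranslation.
End Translations.

(** * Uniform estimates over all subsets of an index set *)

Section BaireSubsets.
Variable I : choiceType.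
Implicit Types (F : {fset I}) (M : set I).

Definition agree_on F M M' : Prop := forall i, i \in F -> (M i <-> M' i).

(** The Baire category theorem for the compact space of subsets of [I], whose
    topology is generated by the cylinders [agree_on F M M0]: if the closed sets
    where [bad n] fails cover the space, one of them contains a cylinder.
    Otherwise any cylinder contains a smaller one on which [bad n] holds, and a
    point common to a decreasing sequence of such cylinders is bad for all
    [n]. *)
Lemma baire_subsets (bad : nat -> set I -> Prop) :
  (forall n M, bad n M -> exists F, forall M', agree_on F M M' -> bad n M') ->
  (forall M, exists n, ~ bad n M) ->
  exists n F M0, forall M, agree_on F M M0 -> ~ bad n M.
Proof.
move=> bad_open bad_ex; apply: contrapT => h.
have step (p : nat * ({fset I} * set I)) : exists q : {fset I} * set I,
    [/\ (p.2.1 `<=` q.1)%fset, agree_on p.2.1 q.2 p.2.2 &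
        forall M, agree_on q.1 q.2 M -> bad p.1 M].
  case: p => n [F M0] /=.
  have [M agM /contrapT /bad_open [F' hF']] :
      exists2 M, agree_on F M M0 & ~ ~ bad n M.
    apply: contrapT => hM; apply: h; exists n, F, M0 => M agM badM.
    by apply: hM; exists M.
  exists ((F `|` F')%fset, M); split=> //=; first exact: fsubsetUl.
  move=> M' ag; apply: hF' => i iF'; apply: ag.
  by rewrite in_fsetU iF' orbT.
have [next hnext] := choice step.
pose st := fix st n := if n is n'.+1 then next (n', st n') else (fset0, set0).
have stS n : [/\ ((st n).1 `<=` (st n.+1).1)%fset,
    agree_on (st n).1 (st n.+1).2 (st n).2 &
    forall M, agree_on (st n.+1).1 (st n.+1).2 M -> bad n M].
  exact: (hnext (n, st n)).
have mono n k : ((st n).1 `<=` (st (n + k)%N).1)%fset /\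
    agree_on (st n).1 (st (n + k)%N).2 (st n).2.
  elim: k => [|k [sub ag]]; first by rewrite addn0; split.
  rewrite addnS; have [sub' ag' _] := stS (n + k)%N.
  split; first exact: fsubset_trans sub'.
  by move=> i iF; rewrite (ag' i) ?(fsubsetP sub)// ag.
pose M := [set i | exists2 n, i \in (st n).1 & (st n).2 i].
have agM n : agree_on (st n).1 (st n).2 M.
  move=> i iF; split=> [Mi|[m im Mi]]; first by exists n.
  have [nm|/ltnW mn] := leqP n m.
    by have [_ /(_ i iF)] := mono n (m - n)%N; rewrite subnKC// => <-.
  by have [_ /(_ i im)] := mono m (n - m)%N; rewrite subnKC// => ->.
have [n] := bad_ex M; apply.
by have [_ _] := stS n; apply; apply: agM.
Qed.

End BaireSubsets.

Lemma uniform_on_seq (T : eqType) (P : T -> nat -> Prop) (s : seq T) :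
  (forall t n m, (n <= m)%N -> P t n -> P t m) ->
  (forall t, t \in s -> exists n, P t n) ->
  exists n, forall t, t \in s -> P t n.
Proof.
move=> mono; elim: s => [|t s IH] h; first by exists 0%N.
have [n hn] := IH (fun u us => h u (mem_behead (s := t :: s) us)).
have [m hm] := h t (mem_head _ _).
exists (maxn n m) => u; rewrite inE => /predU1P[->|/hn].
  by apply: mono hm; rewrite leq_maxr.
by apply: mono; rewrite leq_maxl.
Qed.

(** * Algebras of Roe type and spatially implemented isomorphisms *)

Section RoeLike.
Variables (R : realType) (H : normedModType R[i]) (dot : {dot H for Num.conj}).

(** The common features of the algebra of operators of finite propagation and
    of its closure.  The domain [D] consists of the vectors that span the
    operators of rank one in [A]: the finitely supported ones for the former,
    all vectors for the latter. *)
Record roe_like (X : metricType R) (A : set (l2 X H -> l2 X H))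
    (D : set (l2 X H)) : Prop := RoeLike {
  D_single : forall x a, D (single x a);
  D_zero : D 0;
  D_add : forall u v, D u -> D v -> D (u + v);
  D_scale : forall c u, D u -> D (c *: u);
  D_stable : forall T u, A T -> D u -> D (T u);
  A_rank1 : forall u v, D u -> D v -> A (rank1 dot u v);
  A_trans : forall tau r a b M, (forall x, mdist x (tau x) <= r) ->
    A (fun u => restr M (trans dot tau a b u));
  A_bounded : forall T, A T -> bounded_operator T;
  A_propagation : forall T eps, A T -> 0 < eps -> exists s, forall x a,
    l2norm (restr (~` cball x s) (T (single x a))) <= eps * rnorm a;
  A_finite_rank : forall T eps, A T -> 0 < eps ->
    exists2 s, orthonormal_list dot s &
      forall u, l2norm (T u - projl2 dot s (T u)) <= eps * l2norm u }.

(** [U] and [V] restrict to mutually inverse isometries between [DX] and [DY],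
    and conjugation by them exchanges [A] and [B].  Their values elsewhere are
    arbitrary. *)
Record spatial (X Y : metricType R) (A : set (l2 X H -> l2 X H))
    (DX : set (l2 X H)) (B : set (l2 Y H -> l2 Y H)) (DY : set (l2 Y H))
    (U : l2 X H -> l2 Y H) (V : l2 Y H -> l2 X H) : Prop := Spatial {
  sp_dom : forall u, DX u -> DY (U u);
  sp_cod : forall v, DY v -> DX (V v);
  sp_VU : forall u, DX u -> V (U u) = u;
  sp_UV : forall v, DY v -> U (V v) = v;
  sp_dot : forall u v, DX u -> DX v -> l2dot dot (U u) (U v) = l2dot dot u v;
  sp_add : forall u v, DX u -> DX v -> U (u + v) = U u + U v;
  sp_scale : forall c u, DX u -> U (c *: u) = c *: U u;
  sp_push : forall T, A T -> exists2 S, B S & forall u, DX u -> S (U u) = U (T u);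
  sp_pull : forall S, B S -> exists2 T, A T & forall v, DY v -> T (V v) = V (S v)
}.

Lemma spatial_sym (X Y : metricType R) (A : set (l2 X H -> l2 X H)) DX
    (B : set (l2 Y H -> l2 Y H)) DY U V :
  roe_like A DX -> spatial A DX B DY U V -> spatial B DY A DX V U.
Proof.
move=> hA [Ud Vd VU UV Udot Uadd Uscale push pull]; split=> //.
- by move=> u v hu hv; rewrite -Udot ?UV; auto.
- move=> u v hu hv; rewrite -{1}(UV u)// -{1}(UV v)// -Uadd; auto.
  by rewrite VU//; apply: (D_add hA); auto.
- move=> c u hu; rewrite -{1}(UV u)// -Uscale; auto.
  by rewrite VU//; apply: (D_scale hA); auto.
Qed.

End RoeLike.

Section Implemented.
Variables (R : realType) (H : normedModType R[i]) (dot : {dot H for Num.conj}).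
Hypothesis hdot : norm_of_dot dot.
Variables (X Y : metricType R) (A : set (l2 X H -> l2 X H)) (DX : set (l2 X H))
  (B : set (l2 Y H -> l2 Y H)) (DY : set (l2 Y H))
  (U : l2 X H -> l2 Y H) (V : l2 Y H -> l2 X H).
Hypotheses (hA : roe_like dot A DX) (hB : roe_like dot B DY).
Hypothesis hU : spatial dot A DX B DY U V.

Let hLX := @l2_prehilbert R X H dot hdot.
Let hLY := @l2_prehilbert R Y H dot hdot.

Lemma sp_sub u v : DX u -> DX v -> U (u - v) = U u - U v.
Proof.
move=> hu hv; have hv' := D_scale hA (-1) hv.
have := sp_add hU hu hv'; rewrite (sp_scale hU (-1) hv).
by rewrite (scaleN1r v) (scaleN1r (U v)).
Qed.

Lemma D_sub u v : DX u -> DX v -> DX (u - v).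
Proof.
move=> hu hv; have := D_add hA hu (D_scale hA (-1) hv).
by rewrite (scaleN1r v).
Qed.

Lemma sp_norm u : DX u -> l2norm (U u) = l2norm u.
Proof.
move=> hu; apply/eqP; rewrite -(@eqrXn2 _ 2) ?l2norm_ge0//.
by rewrite !(nrm_sqr hLX, nrm_sqr hLY) (sp_dot hU).
Qed.

(** The operators in question are the [restr M] of a single one, so that on a
    fixed vector they depend, up to a small error, on a finite part of [M];
    and each of them has finite propagation up to a small error.  By the Baire
    argument the bound on the propagation is uniform on a cylinder, hence
    uniform, as [M] differs from a member of the cylinder by one of finitely
    many finite sets. *)
Lemma uniform_propagation (hX : bounded_geometry X) (tau : X -> X) (r : R)
    (a b : H) (eps : R) : (forall x, mdist x (tau x) <= r) -> 0 < eps ->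
  exists n : nat, forall M y c,
    l2norm (restr (~` cball y n%:R)
      (U (restr M (trans dot tau a b (V (single y c)))))) <= eps * rnorm c.
Proof.
move=> htau eps0; pose e := eps / 3.
have e0 : 0 < e by rewrite divr_gt0.
pose z y c := trans dot tau a b (V (single y c)).
have Vs y c : DX (V (single y c)) by apply: (sp_cod hU); apply: (D_single hB).
have zD M y c : DX (restr M (z y c)).
  exact: (D_stable hA (A_trans hA a b M htau)).
pose defect n M y c := l2norm (restr (~` cball y n%:R) (U (restr M (z y c)))).
pose bad n M := exists y c, e * rnorm c < defect n M y c.
have mono n m M : (n <= m)%N -> ~ bad n M -> ~ bad m M.
  move=> nm nb [y [c hc]]; apply: nb; exists y, c; apply: (lt_le_trans hc).
  apply: restr_mono => w /= hw h; apply: hw; apply: (le_trans h).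
  by rewrite ler_nat.
have bad_open n M : bad n M -> exists F : {fset X},
    forall M', agree_on F M M' -> bad n M'.
  move=> [y [c hc]]; set d := defect n M y c in hc.
  have d0 : 0 < (d - e * rnorm c) / 2 by rewrite divr_gt0// subr_gt0.
  have [F hF] := restr_tail hdot (z y c) d0.
  exists F => M' ag; exists y, c.
  have le1 : l2norm (restr M (z y c) - restr M' (z y c)) <=
      l2norm (restr (~` [set` F]) (z y c)).
    exact: (restr_agree hdot).
  have : d <= defect n M' y c + l2norm (restr M (z y c) - restr M' (z y c)).
    rewrite -(sp_norm (D_sub (zD _ _ _) (zD _ _ _))) sp_sub//.
    exact: (restr_sub_le hdot).
  by move=> h; lra.
have bad_ex M : exists n, ~ bad n M.
  have [S hS SE] := sp_push hU (A_trans hA a b M htau).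
  have [s hs] := A_propagation hB hS e0.
  have [n sn] : exists n : nat, s <= n%:R.
    exists (Num.bound `|s|).
    exact: ltW (le_lt_trans (ler_norm s) (archi_boundP (normr_ge0 s))).
  exists n => -[y [c]]; rewrite ltNge => /negP; apply.
  have Ss : S (single y c) = U (restr M (z y c)).
    by have := SE _ (Vs y c); rewrite (sp_UV hU (D_single hB y c)).
  have := hs y c; rewrite Ss; apply: le_trans; apply: restr_mono => w /= hw h; apply: hw.
  exact: le_trans sn.
(* Sets agreeing with [M0] on [F] need propagation [n0], subsets of [F] need [n1]. *)
have [n0 [F [M0 hF]]] := baire_subsets bad_open bad_ex.
have [n1 hn1] : exists n, forall G : {fset X}, G \in fpowerset F ->
    ~ bad n [set` G].
  apply: (@uniform_on_seq {fset X} (fun G n => ~ bad n [set` G])) => [G n m|G _].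
    exact: mono.
  exact: bad_ex.
exists (maxn n0 n1) => M y c.
have good M' n : (n <= maxn n0 n1)%N -> ~ bad n M' ->
    defect (maxn n0 n1) M' y c <= e * rnorm c.
  by move=> /mono h /h nb; rewrite leNgt; apply/negP => lt; apply: nb; exists y, c.
pose M1 := [set x | if x \in F then M0 x else M x].
pose M2 := [set x | (x \in F) && (x \in M0)].
pose M3 := [set` [fset x in F | x \in M]%fset].
have g1 : defect (maxn n0 n1) M1 y c <= e * rnorm c.
  by apply: (good _ n0); rewrite ?leq_maxl//; apply: hF => x xF; rewrite /M1 /= xF.
have g2 : defect (maxn n0 n1) M2 y c <= e * rnorm c.
  apply: (good _ n0); rewrite ?leq_maxl//; apply: hF => x xF; rewrite /M2 /= xF.
  by split=> [/set_mem//|/mem_set].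
have g3 : defect (maxn n0 n1) M3 y c <= e * rnorm c.
  apply: (good _ n1); rewrite ?leq_maxr//; apply: hn1.
  by rewrite fpowersetE; apply/fsubsetP => x; rewrite !inE => /andP[].
have -> : trans dot tau a b (V (single y c)) = z y c by [].
rewrite (restr_split3 F M M0 (z y c)) -/M1 -/M2 -/M3.
rewrite (sp_add hU) ?sp_sub//; last exact: D_sub.
rewrite restrD restrB.
apply: le_trans (nrmD hLY _ _) _; apply: le_trans (lerD (nrmB hLY _ _) (lexx _)) _.
apply: le_trans (lerD (lerD g1 g2) g3) _.
by rewrite le_eqVlt; apply/orP; left; apply/eqP; rewrite /e; field.
Qed.

End Implemented.

(** * Concentration of the images of the basis vectors *)

Lemma positive_on_seq (R : realType) (T : eqType) (P : T -> R -> Prop) (s : seq T) :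
  (forall t c d, d <= c -> P t c -> P t d) ->
  (forall t, t \in s -> exists2 c, 0 < c & P t c) ->
  exists2 c, 0 < c & forall t, t \in s -> P t c.
Proof.
move=> mono; elim: s => [|t s IH] h; first by exists 1.
have [c c0 hc] := IH (fun u us => h u (mem_behead (s := t :: s) us)).
have [d d0 hd] := h t (mem_head _ _).
exists (Num.min c d); first by rewrite lt_min c0.
move=> u; rewrite inE => /predU1P[->|/hc].
  by apply: mono hd; rewrite ge_min lexx orbT.
by apply: mono; rewrite ge_min lexx.
Qed.

Section Concentration.
Variables (R : realType) (H : normedModType R[i]) (dot : {dot H for Num.conj}).
Hypothesis hdot : norm_of_dot dot.
Variables (X Y : metricType R) (A : set (l2 X H -> l2 X H)) (DX : set (l2 X H))
  (B : set (l2 Y H -> l2 Y H)) (DY : set (l2 Y H))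
  (U : l2 X H -> l2 Y H) (V : l2 Y H -> l2 X H).
Hypotheses (hA : roe_like dot A DX) (hB : roe_like dot B DY).
Hypothesis hU : spatial dot A DX B DY U V.
Hypotheses (hX : bounded_geometry X) (hY : bounded_geometry Y).

Let hH := dot_prehilbert hdot.
Let hLX := @l2_prehilbert R X H dot hdot.
Let hLY := @l2_prehilbert R Y H dot hdot.
Let hV := spatial_sym hA hU.

Lemma sp_adj u v : DX u -> DY v -> l2dot dot (V v) u = l2dot dot v (U u).
Proof.
by move=> hu hv; rewrite -(sp_dot hU (sp_cod hU hv) hu) (sp_UV hU hv).
Qed.

(** [V] is the adjoint of [U], evaluated on basis vectors: the matrices of [U]
    and [V] are conjugate transposes of each other. *)
Lemma pull_coord y a x c : dot (V (single y a) x) c = dot a (U (single x c) y).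
Proof.
rewrite -(l2dot_singler hdot (V (single y a)) x c).
rewrite (sp_adj (D_single hA x c) (D_single hB y a)).
exact: (l2dot_singlel hdot).
Qed.

Lemma D_sum I (r : seq I) (k : I -> R[i]) (E : I -> l2 Y H) :
  (forall i, DY (E i)) -> DY (\sum_(i <- r) k i *: E i).
Proof.
move=> hE; elim: r => [|i r IH]; first by rewrite big_nil; exact: D_zero hB.
by rewrite big_cons; apply: (D_add hB) => //; apply: (D_scale hB).
Qed.

Lemma pull_sum I (r : seq I) (k : I -> R[i]) (E : I -> l2 Y H) :
  (forall i, DY (E i)) ->
  V (\sum_(i <- r) k i *: E i) = \sum_(i <- r) k i *: V (E i).
Proof.
move=> hE; elim: r => [|i r IH].
  rewrite !big_nil; have := sp_scale hV 0 (D_zero hB).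
  by rewrite (scale0r (0 : l2 Y H)) (scale0r (V 0)).
rewrite !big_cons (sp_add hV); last exact: D_sum.
  by rewrite IH (sp_scale hV _ (hE i)).
exact: (D_scale hB).
Qed.

(** The vectors with values on the line of the unit vector [a] form the range of
    the projection [trans id a a]. *)
Lemma rank_one_id (a : H) (u : l2 Y H) : rnorm a = 1 ->
  (forall y, exists c, u y = c *: a) ->
  restr setT (trans dot id a a u) = u.
Proof.
move=> a1 hu; have hid (y : Y) : mdist y (id y) <= 0 by rewrite mdistxx.
apply: l2_ext => y; rewrite (restrE setT) in_setT (transE hdot hY hid).
have [c ->] := hu y.
by rewrite (ipZl hH) (ipE hH) a1 expr1n mulr1.
Qed.

(** Changing the signs of the coordinates of [U (single x h)] in the direction
    [a] does not affect the norm of the component, but by the greedy choice of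
    signs it can make all the coordinates of the preimage in a given finite
    dimensional space as small as if the terms were orthogonal in that space.
    By uniform propagation, the preimage cannot leave a certain ball
    around [x]; so some coordinate of [U (single x h)] has to be large. *)
Lemma large_coordinate (a h : H) (kappa : R) :
  rnorm a = 1 -> rnorm h = 1 -> 0 < kappa ->
  exists2 c : R, 0 < c & forall x (F : {fset Y}),
    kappa <= \sum_(y <- F) cmod (dot (U (single x h) y) a) ^+ 2 ->
    exists y, c <= cmod (dot (U (single x h) y) a).
Proof.
move=> a1 h1 kappa0; pose q := Num.sqrt kappa.
have q0 : 0 < q by rewrite sqrtr_gt0.
(* Three errors of size [eps] take up half of the norm, which is at least [q]. *)
pose eps := q / 6; have eps0 : 0 < eps by rewrite divr_gt0.
have hid (y : Y) : mdist y (id y) <= 0 by rewrite mdistxx.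
have [n hn] := uniform_propagation hdot hB hA hV hY a a hid eps0.
have [N hN] := cball_fset hX n%:R.
have [T hT TE] := sp_pull hU (A_trans hB a a setT hid).
have [t ht tT] := A_finite_rank hA hT eps0.
pose K : R := (N * size t)%:R.
have K0 : 0 <= K by rewrite ler0n.
(* If all coordinates were below [c], the remaining part would have norm at most
   [c] times the square root of [K], which is less than [q / 2]. *)
pose c := q / (2 * (K + 1)).
have c0 : 0 < c by rewrite divr_gt0// mulr_gt0// ltr_wpDl.
exists c => // x F hF; apply: contrapT => /forallNP small.
pose ux := U (single x h); pose z := trans dot id a a ux.
have Dx : DX (single x h) := D_single hA x h.
have ux1 : l2norm ux = 1.
  by rewrite /ux (sp_norm hdot hU Dx) (l2norm_single hdot) h1.
pose cy y := dot (ux y) a.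
have cyc y : cmod (cy y) <= c by rewrite leNgt; apply/negP => /ltW /small.
have zE y : z y = cy y *: a by exact: (transE hdot hY hid).
pose eta y := V (single y a).
have [Bx hBx cardB] := hN x.
pose P w := restr [set` Bx] (projl2 dot t w).
(* [P] maps onto a space of dimension at most [K]. *)
have [b hb] := greedy_signs hLX (fun y => P (cy y *: eta y)) (fset_uniq F).
pose p := signed_restr F b z.
have pS : p = \sum_(y <- F) (-1) ^+ b y *: single y (z y).
  exact: signed_restr_sum.
have Dp : DY p by rewrite pS; apply: D_sum => y; exact: D_single hB y _.
pose w := V p.
have wS : w = \sum_(y <- F) (-1) ^+ b y *: (cy y *: eta y).
  rewrite /w pS pull_sum => [|y]; last exact: D_single hB y _.
  apply: eq_bigr => y _; rewrite zE singleZ.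
  by rewrite (sp_scale hV _ (D_single hB y a)).
have rp y : rnorm (p y) = if y \in F then cmod (cy y) else 0.
  by rewrite rnorm_signed_restr zE rnormZ -/(cmod _) a1 mulr1.
have wp : l2norm w = l2norm p := sp_norm hdot hV Dp.
have w_ge : q <= l2norm w.
  rewrite -(@ler_pXn2r _ 2)// ?nnegrE ?l2norm_ge0 ?(ltW q0)//.
  rewrite sqr_sqrtr ?(ltW kappa0)// (le_trans hF)// wp.
  rewrite (le_trans _ (sum_le_l2norm p F))// big_seq [leRHS]big_seq.
  by apply: ler_sum => y yF; rewrite rp yF.
have w_le : l2norm w <= 1.
  rewrite wp -ux1; apply: l2norm_mono => y; rewrite rp.
  case: ifP => _; last exact: rnorm_ge0.
  by have := cauchy_schwarz hH (ux y) a; rewrite a1 mulr1.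
have far : l2norm (restr (~` [set` Bx]) w) <= eps + eps.
  have hz M : l2norm (restr (~` [set` Bx]) (V (restr M z))) <= eps.
    by have := hn M x h; rewrite h1 mulr1 hBx.
  have Dz M : DY (restr M z).
    exact: (D_stable hB (A_trans hB a a M hid) (sp_dom hU Dx)).
  rewrite /w /p /signed_restr (sp_sub hB hV (Dz _) (Dz _)).
  rewrite (restrB (~` [set` Bx]) (V _)).
  exact: le_trans (nrmB hLX _ _) (lerD (hz _) (hz _)).
have Tw : T w = w.
  rewrite /w TE// rank_one_id// => y; rewrite /p signed_restrE.
  case: ifP => _; last by exists 0; rewrite scale0r.
  by rewrite zE scalerA; eexists.
have outside : l2norm (w - projl2 dot t w) <= eps.
  have := tT w; rewrite Tw => hw; apply: (le_trans hw).
  by rewrite ger_pMr.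
have PwE : P w = \sum_(y <- F) (-1) ^+ b y *: P (cy y *: eta y).
  by rewrite wS; apply: (restr_proj_sum hdot).
have PE y : l2norm (P (cy y *: eta y)) ^+ 2 <=
    c ^+ 2 * \sum_(x' <- Bx) \sum_(f <- t) rnorm (U (single x' f) y) ^+ 2.
  rewrite /P (projl2Z hdot ht) (restrZ _ (cy y)) (nrmZ hLX) exprMn.
  apply: ler_pM; rewrite ?sqr_ge0//.
    by rewrite lerXn2r ?nnegrE ?cmod_ge0 ?(ltW c0).
  rewrite restr_fset_sqr; apply: ler_sum => x' _.
  rewrite (projl2E hdot (eta y) x' ht) (nrm_proj hH _ ht).
  apply: ler_sum => f _; rewrite pull_coord.
  rewrite lerXn2r ?nnegrE ?cmod_ge0 ?rnorm_ge0//.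
  by have := cauchy_schwarz hH a (U (single x' f) y); rewrite a1 mul1r.
have Pw_le : l2norm (P w) ^+ 2 <= c ^+ 2 * K.
  rewrite PwE (le_trans hb)// (le_trans (ler_sum _ (fun y _ => PE y)))//.
  rewrite -mulr_sumr ler_wpM2l ?sqr_ge0// exchange_big /=.
  have f1 f : f \in t -> rnorm f = 1.
    move=> ft; apply/eqP; rewrite -(@eqrXn2 _ 2) ?rnorm_ge0//.
    apply/eqP; rewrite (nrm_sqr hH) ht.2// eqxx expr1n//.
  have bound x' : \sum_(y <- F) \sum_(f <- t) rnorm (U (single x' f) y) ^+ 2
      <= (size t)%:R.
    rewrite exchange_big /= -sum1_size natr_sum big_seq [leRHS]big_seq.
    apply: ler_sum => f ft; apply: (le_trans (sum_le_l2norm _ _)).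
    rewrite (sp_norm hdot hU (D_single hA x' f)) (l2norm_single hdot) f1//.
    by rewrite expr1n.
  apply: (le_trans (ler_sum _ (fun x' _ => bound x'))).
  rewrite /K natrM big_const_seq count_predT iter_addr_0 -[leLHS]mulr_natl.
  by rewrite ler_wpM2r// ler_nat.
have total := three_parts hdot [set` Bx] w ht.
have Pw0 : q / 2 <= l2norm (P w).
  rewrite -/(P w) in total; move: far outside w_ge total; rewrite /eps.
  move: (l2norm w) (l2norm (restr (~` _) w)) (l2norm (w - _)) (l2norm (P w)).
  by move=> r1 r2 r3 r4; lra.
have cK : c * (K + 1) = q / 2.
  by rewrite /c; field; rewrite lt0r_neq0// ltr_wpDl.
have : (c * (K + 1)) ^+ 2 <= c ^+ 2 * K.
  rewrite cK; apply: le_trans Pw_le.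
  by rewrite lerXn2r ?nnegrE ?l2norm_ge0// divr_ge0// ltW.
rewrite exprMn ler_pM2l ?exprn_gt0// leNgt -subr_gt0.
rewrite (_ : (K + 1) ^+ 2 - K = K ^+ 2 + K + 1); last by ring.
by rewrite ltr_wpDl// addr_ge0// sqr_ge0.
Qed.

(** Every [U (single x h)] lies in the range of the image of the projection
    onto [h] in each fibre, which is close to a space of functions with values
    in a finite dimensional space.  So a fixed share of its mass is in the
    direction of one of finitely many vectors. *)
Lemma concentration (h : H) : rnorm h = 1 ->
  exists2 s : seq H, orthonormal_list dot s & exists2 c : R, 0 < c &
    forall x, exists2 a, a \in s &
      exists y, c <= cmod (dot (U (single x h) y) a).
Proof.
move=> h1; have hid (x : X) : mdist x (id x) <= 0 by rewrite mdistxx.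
have [S hS SE] := sp_push hU (A_trans hA h h setT hid).
have half0 : 0 < 2^-1 :> R by rewrite invr_gt0.
have [s hs sS] := A_finite_rank hB hS half0.
exists s => //.
have s1 f : f \in s -> rnorm f = 1.
  move=> ft; apply/eqP; rewrite -(@eqrXn2 _ 2) ?rnorm_ge0//.
  by apply/eqP; rewrite (nrm_sqr hH) hs.2// eqxx expr1n.
(* The component with values in the span of [s] has squared norm at least 1/4;
   a finite set carries at least 1/8 of it, which is shared by [size s]
   directions. *)
pose kappa : R := (8 * (size s)%:R + 1)^-1.
have kappa0 : 0 < kappa by rewrite invr_gt0 ltr_wpDl ?mulr_ge0.
pose good f c := forall x (F : {fset Y}),
    kappa <= \sum_(y <- F) cmod (dot (U (single x h) y) f) ^+ 2 ->
    exists y, c <= cmod (dot (U (single x h) y) f).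
have [c c0 hc] : exists2 c, 0 < c & forall f, f \in s -> good f c.
  apply: positive_on_seq => [f c d dc hf x F /hf[y hy]|f /s1 f1].
    by exists y; apply: le_trans hy.
  exact: large_coordinate.
exists c => // x; apply: contrapT => none.
have Dx : DX (single x h) := D_single hA x h.
pose ux := U (single x h).
have Sux : S ux = ux.
  rewrite /ux SE//; congr U; apply: l2_ext => y.
  rewrite (restrE setT) in_setT (transE hdot hX hid) !singleE.
  by case: ifP => _; rewrite ?(ip0l hH) ?scale0r// (ipE hH) h1 expr1n scale1r.
have ux1 : l2norm ux = 1.
  by rewrite /ux (sp_norm hdot hU Dx) (l2norm_single hdot) h1.
have near : 2^-1 <= l2norm (projl2 dot s ux).
  have := sS ux; rewrite Sux ux1 mulr1 => small.
  have := nrmD hLY (ux - projl2 dot s ux) (projl2 dot s ux).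
  by rewrite subrK ux1; lra.
have e8 : 0 < 8^-1 :> R by rewrite invr_gt0.
have [F /(_ F (fsubset_refl F)) hF] := l2norm_approx (projl2 dot s ux) e8.
have low f : f \in s -> \sum_(y <- F) cmod (dot (ux y) f) ^+ 2 <= kappa.
  move=> fs; rewrite leNgt; apply/negP => /ltW /(hc f fs x F)[y hy].
  by apply: none; exists f => //; exists y.
have sum_le : \sum_(y <- F) rnorm (projl2 dot s ux y) ^+ 2 <= (size s)%:R * kappa.
  rewrite (eq_bigr (fun y => \sum_(f <- s) cmod (dot (ux y) f) ^+ 2)); last first.
    by move=> y _; rewrite (projl2E hdot ux y hs) (nrm_proj hH _ hs).
  rewrite exchange_big big_seq /= (le_trans (ler_sum _ low))//.
  by rewrite -big_seq big_const_seq count_predT iter_addr_0 mulr_natl.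
have : 8 * ((size s)%:R * kappa) < 1.
  have m0 : 0 < 8 * (size s)%:R + 1 :> R by rewrite ltr_wpDl ?mulr_ge0.
  by rewrite mulrA /kappa ltr_pdivrMr// mul1r ltrDl.
move: near hF sum_le; move: (l2norm _) (\sum_(y <- F) _) ((size s)%:R * kappa).
by move=> u v w; nra.
Qed.

End Concentration.

(** * The coarse equivalence *)

Section MatrixUnits.
Variables (R : realType) (H : normedModType R[i]) (dot : {dot H for Num.conj}).
Hypothesis hdot : norm_of_dot dot.
Variables (X Y : metricType R) (A : set (l2 X H -> l2 X H)) (DX : set (l2 X H))
  (B : set (l2 Y H -> l2 Y H)) (DY : set (l2 Y H))
  (U : l2 X H -> l2 Y H) (V : l2 Y H -> l2 X H).
Hypotheses (hA : roe_like dot A DX) (hB : roe_like dot B DY).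
Hypothesis hU : spatial dot A DX B DY U V.
Hypothesis hX : bounded_geometry X.

Let hH := dot_prehilbert hdot.
Let hLY := @l2_prehilbert R Y H dot hdot.

(** The image of a matrix unit between two fibres at bounded distance is the
    rank one operator made of two vectors [U (single _ _)]; this is uniform
    propagation for these operators. *)
Lemma matrix_unit_propagation (tau : X -> X) (r : R) (a b : H) (eps : R) :
  (forall x, mdist x (tau x) <= r) -> 0 < eps ->
  exists n : nat, forall x y c,
    cmod (dot c (U (single (tau x) b) y)) *
      l2norm (restr (~` cball y n%:R) (U (single x a))) <= eps * rnorm c.
Proof.
move=> htau eps0.
have [n hn] := uniform_propagation hdot hA hB hU hX a b htau eps0.
exists n => x y c; have := hn [set x] y c.
have -> : restr [set x] (trans dot tau a b (V (single y c))) =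
    dot c (U (single (tau x) b) y) *: single x a.
  rewrite -(pull_coord hdot hA hB hU).
  apply: l2_ext => x'; rewrite restrE (transE hdot hX htau).
  rewrite (l2ZE _ (single x a)) singleE in_set1.
  by case: eqP => [->|_]; rewrite ?scaler0.
rewrite (sp_scale hU _ (D_single hA x a)).
by rewrite (restrZ (~` cball y n%:R)) (nrmZ hLY).
Qed.

Lemma far_coordinate (M : set Y) (u : l2 Y H) y : ~ M y ->
  rnorm (u y) <= l2norm (restr (~` M) u).
Proof.
move=> nM; have := rnorm_le_l2norm (restr (~` M) u) y.
by rewrite restrE ifT//; apply: mem_set.
Qed.

(** For [mdist x1 x2 <= r] the matrix unit from [x1] to [x2] shows that
    [U (single x2 h)] is concentrated near any point where [U (single x1 h)] has
    a large coordinate, such as [f x1]; so [f x2] is near [f x1].  Enumerating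
    the balls of radius [r] covers all pairs [(x1, x2)] by finitely many maps
    [tau]. *)
Lemma large_coordinate_expansive (h : H) (c : R) (f : X -> Y) : 0 < c ->
  (forall x, c <= rnorm (U (single x h) (f x))) -> uniformly_expansive f.
Proof.
move=> c0 hf r r0.
have [N hN] := cball_fset hX r.
have balls x : exists F : {fset X}, [set` F] = cball x r /\ (#|` F| <= N)%N.
  by have [F ? ?] := hN x; exists F.
have [Bx hBx] := choice balls.
pose tau i x := nth x (enum_fset (Bx x)) i.
have htau i x : mdist x (tau i x) <= r.
  have [iB|Bi] := ltnP i (size (enum_fset (Bx x))); last first.
    by rewrite /tau nth_default// mdistxx ltW.
  have : [set` Bx x] (tau i x) by exact: mem_nth.
  by rewrite (hBx x).1.
have eps0 : 0 < c ^+ 2 / 2 by rewrite divr_gt0// exprn_gt0.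
pose good i n := forall x y v, cmod (dot v (U (single (tau i x) h) y)) *
      l2norm (restr (~` cball y n%:R) (U (single x h))) <= c ^+ 2 / 2 * rnorm v.
have [n hn] : exists n : nat, forall i, i \in iota 0 N -> good i n.
  apply: uniform_on_seq => [i n m nm hn x y v|i _].
    apply: le_trans (hn x y v); rewrite ler_wpM2l ?cmod_ge0//.
    apply: restr_mono => w /= hw hw'; apply: hw; apply: (le_trans hw').
    by rewrite ler_nat.
  exact: matrix_unit_propagation (htau i) eps0.
exists (n%:R + 1); first by rewrite ltr_wpDl.
move=> x1 x2 d12; have x1B : x1 \in Bx x2.
  have : cball x2 r x1 by rewrite /cball /= metric_sym.
  by rewrite -(hBx x2).1.
pose i := index x1 (enum_fset (Bx x2)).
have tau_i : tau i x2 = x1 by rewrite /tau nth_index.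
have iN : i \in iota 0 N.
  rewrite mem_iota /= add0n; apply: leq_trans (hBx x2).2.
  by rewrite index_mem.
apply: contrapT => far.
pose v := U (single x1 h) (f x1).
have := hn i iN x2 (f x1) v; rewrite tau_i -/v (ipE hH).
rewrite cmod_real ?sqr_ge0//; apply/negP; rewrite -ltNge.
have nb : ~ cball (f x1) n%:R (f x2).
  by move=> /= near; apply: far; apply: (le_trans near); rewrite lerDl.
have large := le_trans (hf x2) (far_coordinate (U (single x2 h)) nb).
have cv : c <= rnorm v := hf x1.
rewrite (expr2 (rnorm v)) (mulrAC (rnorm v)) ltr_pM2r; last exact: lt_le_trans cv.
apply: (@lt_le_trans _ _ (c * c)).
  by rewrite -expr2 ltr_pdivrMr// ltr_pMr ?exprn_gt0// ltr1n.
by apply: ler_pM => //; exact: ltW.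
Qed.

End MatrixUnits.

Section Coarse.
Variables (R : realType) (H : normedModType R[i]) (dot : {dot H for Num.conj}).
Hypothesis hdot : norm_of_dot dot.
Variables (X Y : metricType R) (A : set (l2 X H -> l2 X H)) (DX : set (l2 X H))
  (B : set (l2 Y H -> l2 Y H)) (DY : set (l2 Y H))
  (U : l2 X H -> l2 Y H) (V : l2 Y H -> l2 X H).
Hypotheses (hA : roe_like dot A DX) (hB : roe_like dot B DY).
Hypothesis hU : spatial dot A DX B DY U V.
Hypotheses (hX : bounded_geometry X) (hY : bounded_geometry Y).

Let hH := dot_prehilbert hdot.

(** If [y = f x], the vector [V (single y a)] has a large coordinate at [x] for
    one of the finitely many directions [a]; and by uniform propagation it is
    concentrated around the point [g y] where [V (single y h)] is large. *)
Lemma large_coordinates_close (h : H) (s : seq H) (c d : R)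
    (f : X -> Y) (g : Y -> X) : rnorm h = 1 -> 0 < c -> 0 < d ->
  (forall x, exists2 a, a \in s & c <= cmod (dot (U (single x h) (f x)) a)) ->
  (forall y, d <= rnorm (V (single y h) (g y))) ->
  Defs.close (g \o f) id.
Proof.
move=> h1 c0 d0 hf hg; have hV := spatial_sym hA hU.
have hid (y : Y) : mdist y (id y) <= 0 by rewrite mdistxx.
have eps0 : 0 < c * d / 2 by rewrite divr_gt0// mulr_gt0.
pose good a n := forall y x v, cmod (dot v (V (single y h) x)) *
      l2norm (restr (~` cball x n%:R) (V (single y a))) <= c * d / 2 * rnorm v.
have [n hn] : exists n : nat, forall a, a \in s -> good a n.
  apply: uniform_on_seq => [a n m nm hn y x v|a _].
    apply: le_trans (hn y x v); rewrite ler_wpM2l ?cmod_ge0//.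
    apply: restr_mono => w /= hw hw'; apply: hw; apply: (le_trans hw').
    by rewrite ler_nat.
  by have := matrix_unit_propagation hdot hB hA hV hY a h hid eps0.
exists (n%:R + 1); first by rewrite ltr_wpDl.
move=> x; have [a as_ ca] := hf x; apply: contrapT => far.
pose v := V (single (f x) h) (g (f x)).
have := hn a as_ (f x) (g (f x)) v; rewrite -/v (ipE hH).
rewrite cmod_real ?sqr_ge0//; apply/negP; rewrite -ltNge.
have nb : ~ cball (g (f x)) n%:R x.
  by move=> /= near; apply: far; apply: (le_trans near); rewrite lerDl.
have large : c <= l2norm (restr (~` cball (g (f x)) n%:R) (V (single (f x) a))).
  apply: le_trans (far_coordinate (V (single (f x) a)) nb).
  apply: (le_trans ca).
  have := cauchy_schwarz hH (V (single (f x) a) x) h.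
  rewrite h1 mulr1 (pull_coord hdot hA hB hU) => /(le_trans _); apply.
  by rewrite (ipC hH) cmod_conj.
have dv : d <= rnorm v := hg (f x).
rewrite (expr2 (rnorm v)) (mulrAC (rnorm v)) ltr_pM2r; last exact: lt_le_trans dv.
apply: (@lt_le_trans _ _ (d * c)).
  by rewrite (mulrC d) ltr_pdivrMr// ltr_pMr ?mulr_gt0// ltr1n.
by apply: ler_pM => //; exact: ltW.
Qed.

End Coarse.

Section CoarseEquivalence.
Variables (R : realType) (H : normedModType R[i]) (dot : {dot H for Num.conj}).
Hypothesis hdot : norm_of_dot dot.

Lemma spatial_large_map (X Y : metricType R) (A : set (l2 X H -> l2 X H)) DX
    (B : set (l2 Y H -> l2 Y H)) DY U V (h : H) :
  bounded_geometry X -> bounded_geometry Y ->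
  roe_like dot A DX -> roe_like dot B DY -> spatial dot A DX B DY U V ->
  rnorm h = 1 ->
  exists (f : X -> Y) (s : seq H) (c : R), [/\ 0 < c,
    forall x, exists2 a, a \in s & c <= cmod (dot (U (single x h) (f x)) a) &
    forall x, c <= rnorm (U (single x h) (f x))].
Proof.
move=> hX hY hA hB hU h1.
have [s hs [c c0 hc]] := concentration hdot hA hB hU hX hY h1.
have points x : exists y, exists2 a, a \in s & c <= cmod (dot (U (single x h) y) a).
  by have [a as_ [y hy]] := hc x; exists y, a.
have [f hf] := choice points.
exists f, s, c; split=> // x; have [a as_ ha] := hf x; apply: (le_trans ha).
have a1 : rnorm a = 1.
  apply/eqP; rewrite -(@eqrXn2 _ 2) ?rnorm_ge0//.
  by apply/eqP; rewrite (nrm_sqr (dot_prehilbert hdot)) hs.2// eqxx expr1n.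
by have := cauchy_schwarz (dot_prehilbert hdot) (U (single x h) (f x)) a;
  rewrite a1 mulr1.
Qed.

Lemma spatial_coarsely_equivalent (X Y : metricType R)
    (A : set (l2 X H -> l2 X H)) DX (B : set (l2 Y H -> l2 Y H)) DY U V (h : H) :
  bounded_geometry X -> bounded_geometry Y ->
  roe_like dot A DX -> roe_like dot B DY -> spatial dot A DX B DY U V ->
  rnorm h = 1 -> coarsely_equivalent X Y.
Proof.
move=> hX hY hA hB hU h1; have hV := spatial_sym hA hU.
have [f [s [c [c0 hf hfc]]]] := spatial_large_map hX hY hA hB hU h1.
have [g [t [d [d0 hg hgd]]]] := spatial_large_map hY hX hB hA hV h1.
exists f, g; split.
- by have := large_coordinate_expansive hdot hA hB hU hX c0 hfc.
- by have := large_coordinate_expansive hdot hB hA hV hY d0 hgd.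
- by have := large_coordinates_close hdot hB hA hV hX h1 d0 c0 hg hfc.
- by have := large_coordinates_close hdot hA hB hU hY h1 c0 d0 hf hgd.
Qed.

End CoarseEquivalence.

(** * Isomorphisms are implemented by isometries *)

Section LinearMaps.
Variables (K : pzRingType) (E F : lmodType K) (T : E -> F).
Hypothesis hT : linear T.

Lemma linear_map0 : T 0 = 0.
Proof.
have := hT (-1) 0 0; rewrite scaler0 addr0 scaleN1r => h.
by rewrite h addrC subrr.
Qed.

Lemma linear_mapZ c u : T (c *: u) = c *: T u.
Proof. by have := hT c u 0; rewrite linear_map0 !addr0. Qed.

Lemma linear_mapD u v : T (u + v) = T u + T v.
Proof. by have := hT 1 u v; rewrite !scale1r. Qed.

Lemma linear_map_sum I (r : seq I) (G : I -> E) :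
  T (\sum_(i <- r) G i) = \sum_(i <- r) T (G i).
Proof.
elim: r => [|i r IH]; first by rewrite !big_nil linear_map0.
by rewrite !big_cons linear_mapD IH.
Qed.

End LinearMaps.

Section RankOne.
Variables (R : realType) (X : choiceType) (H : normedModType R[i]).
Variable dot : {dot H for Num.conj}.
Hypothesis hdot : norm_of_dot dot.
Implicit Types (u v w : l2 X H).

Let hL := @l2_prehilbert R X H dot hdot.

Lemma rank1D u v w :
  rank1 dot (u + v) w = (rank1 dot u w \+ rank1 dot v w)%R.
Proof. by apply/funext => x; rewrite /rank1 /= scalerDr. Qed.

Lemma rank1Z c u w : rank1 dot (c *: u) w = (c \*: rank1 dot u w)%R.
Proof. by apply/funext => x; rewrite /rank1 /= !scalerA mulrC. Qed.

Lemma comp_rank1 (T : l2 X H -> l2 X H) u v : linear T ->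
  T \o rank1 dot u v = rank1 dot (T u) v.
Proof. by move=> hT; apply/funext => x; rewrite /rank1 /= (linear_mapZ hT). Qed.

Lemma rank1_comp u v w z :
  rank1 dot u v \o rank1 dot w z = (l2dot dot w v \*: rank1 dot u z)%R.
Proof.
by apply/funext => x; rewrite /rank1 /= (ipZl hL) scalerA mulrC.
Qed.

Lemma rank1_adjoint u v : adjoint_of dot (rank1 dot u v) (rank1 dot v u).
Proof.
move=> w z; rewrite /rank1 (ipZl hL) (ipZr hL) mulrC.
by rewrite [in RHS](ipC hL u z) conjcK mulrC.
Qed.

Lemma unit_scale u : u != 0 -> ((l2norm u)^-1 ^+ 2)%:C * l2dot dot u u = 1.
Proof.
move=> u0; rewrite (ipE hL) -rmorphM -exprMn mulVf ?expr1n//.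
by apply: contra_neq u0 => /(l2norm_eq0).
Qed.

Lemma rank1_normalize u v :
  rank1 dot ((l2norm u)^-1%:C *: u) ((l2norm u)^-1%:C *: u) v =
  (((l2norm u)^-1 ^+ 2)%:C * l2dot dot v u) *: u.
Proof.
rewrite /rank1 (ipZr hL) conjc_real scalerA; congr (_ *: _).
by rewrite mulrAC -rmorphM -expr2.
Qed.

(** This is the density of the finitely supported functions. *)
Lemma bounded_ext0 (T : l2 X H -> l2 X H) : bounded_operator T ->
  (forall y a, T (single y a) = 0) -> forall u, T u = 0.
Proof.
move=> bT T0 u; have hT := bT.1; apply: l2norm_eq0; apply/eqP.
rewrite eq_le l2norm_ge0 andbT; apply/ler_addgt0Pl => e e0; rewrite addr0.
have [C C0 hC] := bounded_operator_pos bT.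
have [F hF] := restr_tail hdot u (divr_gt0 e0 C0).
rewrite (restr_split [set` F] u) (linear_mapD hT) restr_fset (linear_map_sum hT).
rewrite big1 ?add0r => [|y _]; last exact: T0.
by rewrite (le_trans (hC _))// mulrC -ler_pdivlMr.
Qed.

End RankOne.

Section Implementation.
Variables (R : realType) (H : normedModType R[i]) (dot : {dot H for Num.conj}).
Hypothesis hdot : norm_of_dot dot.
Variables (X Y : metricType R) (A : set (l2 X H -> l2 X H)) (DX : set (l2 X H))
  (B : set (l2 Y H -> l2 Y H)) (DY : set (l2 Y H)).
Variable phi : (l2 X H -> l2 X H) -> (l2 Y H -> l2 Y H).
Hypotheses (hA : roe_like dot A DX) (hB : roe_like dot B DY).
Hypothesis hphi : star_isomorphism dot A B phi.

Let hLX := @l2_prehilbert R X H dot hdot.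
Let hLY := @l2_prehilbert R Y H dot hdot.

Lemma phi_in T : A T -> B (phi T).
Proof. by case: hphi => -[h _ _] _; exact: h. Qed.

Lemma phi_surj S : B S -> exists2 T, A T & phi T = S.
Proof. by case: hphi => -[_ _ h] _ /h[T hT <-]; exists T. Qed.

Lemma phi_inj S T : A S -> A T -> phi S = phi T -> S = T.
Proof. by case: hphi => -[_ h _] _ hS hT; apply: h; exact: mem_set. Qed.

Lemma phiD S T u : A S -> A T -> phi (S \+ T)%R u = phi S u + phi T u.
Proof. by move=> hS hT; have [_ /(_ S T hS hT)[-> _ _ _]] := hphi. Qed.

Lemma phiZ T c u : A T -> phi (c \*: T)%R u = c *: phi T u.
Proof. by move=> hT; have [_ /(_ T T hT hT)[_ -> _ _]] := hphi. Qed.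

Lemma phiM S T u : A S -> A T -> phi (S \o T) u = phi S (phi T u).
Proof. by move=> hS hT; have [_ /(_ S T hS hT)[_ _ -> _]] := hphi. Qed.

Lemma phi_adj S T u v : A S -> A T -> adjoint_of dot S T ->
  l2dot dot (phi S u) v = l2dot dot u (phi T v).
Proof.
by move=> hS hT hST; have [_ /(_ S T hS hT)[_ _ _ /(_ hST)]] := hphi; apply.
Qed.

Variables (x0 : X) (h : H).
Hypothesis h1 : rnorm h = 1.
Let e0 : l2 X H := single x0 h.
Let De0 : DX e0 := D_single hA x0 h.

Lemma e0_unit : l2dot dot e0 e0 = 1.
Proof. by rewrite (ipE hLX) (l2norm_single hdot) h1 expr1n. Qed.

(** Minimality of the projection onto [e0] is expressed in the algebra, and it
    passes to its image, which is thus a projection of rank one. *)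
Lemma image_rank1 : exists2 xi, DY xi & l2dot dot xi xi = 1 /\
  forall u, phi (rank1 dot e0 e0) u = rank1 dot xi xi u.
Proof.
pose th := rank1 dot e0 e0; pose p := phi th.
have Ath : A th := A_rank1 hA De0 De0.
have Bp : B p := phi_in Ath.
have lin_p : linear p := (A_bounded hB Bp).1.
have pp u : p (p u) = p u.
  rewrite /p -phiM// /th (rank1_comp hdot) e0_unit phiZ//.
  by rewrite (scale1r (phi _ u)).
have p_adj u v : l2dot dot (p u) v = l2dot dot u (p v).
  exact: (phi_adj u v Ath Ath (rank1_adjoint hdot e0 e0)).
have [y [a pt0]] : exists y a, p (single y a) != 0.
  apply: contrapT => none.
  have p0 u : p u = 0.
    apply: (bounded_ext0 hdot (A_bounded hB Bp)) => y a; apply: contrapT => /eqP n0.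
    by apply: none; exists y, a.
  have A2 : A (rank1 dot (2 *: e0) e0) := A_rank1 hA (D_scale hA 2 De0) De0.
  have : th = rank1 dot (2 *: e0) e0.
    apply: phi_inj => //; apply/funext => u.
    rewrite rank1Z phiZ//; have := p0 u; rewrite /p /th => ->.
    by rewrite (scaler0 (l2 Y H) 2).
  move=> /(congr1 (fun T => l2dot dot (T e0) e0)).
  rewrite /th /rank1 e0_unit !(ipZl hLX) e0_unit !mulr1 => /eqP.
  by rewrite eq_sym -subr_eq0 (_ : 1 * 2 - 1 = 1) ?oner_eq0//; ring.
pose t := single y a; pose q := p t.
have Dt : DY t := D_single hB y a.
have Dq : DY q := D_stable hB Bp Dt.
have [S AS phiS] := phi_surj (A_rank1 hB Dt Dt).
pose lam := l2dot dot (S e0) e0.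
have lin_S : linear S := (A_bounded hA AS).1.
have compress u : l2dot dot u q *: q = lam *: p u.
  have ASe : A (rank1 dot (S e0) e0) := A_rank1 hA (D_stable hA AS De0) De0.
  have -> : lam *: p u = phi (th \o (S \o th)) u.
    by rewrite /th (comp_rank1 dot _ _ lin_S) (rank1_comp hdot) phiZ.
  rewrite phiM//; last by rewrite /th (comp_rank1 dot _ _ lin_S).
  rewrite phiM// phiS -/p {1}/rank1 (linear_mapZ lin_p) -/q.
  by rewrite p_adj.
have q0 : q != 0 := pt0.
have nq0 : l2norm q != 0 by apply: contra_neq q0 => /(l2norm_eq0).
have lamE : lam = l2dot dot q q.
  have := compress q; rewrite {3}/q pp => /eqP.
  rewrite -subr_eq0 -scalerBl scaler_eq0 (negbTE q0) orbF subr_eq0.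
  by move/eqP.
exists ((l2norm q)^-1%:C *: q); first exact: (D_scale hB _ Dq).
split.
  rewrite (ipZl hLY) (ipZr hLY) conjc_real mulrA -rmorphM -expr2.
  exact: (unit_scale hdot).
move=> u; rewrite (rank1_normalize hdot) -scalerA compress lamE scalerA.
by rewrite (unit_scale hdot)// scale1r.
Qed.

(** Transporting [u] to [phi (rank1 u e0) xi], where [phi (rank1 e0 e0)] is the
    projection onto [xi], preserves inner products since [phi] preserves
    adjoints. *)
Lemma isomorphism_spatial : exists U V, spatial dot A DX B DY U V.
Proof.
have [xi Dxi [xi1 pE]] := image_rank1.
have pxi : phi (rank1 dot e0 e0) xi = xi.
  by rewrite pE /rank1 xi1 scale1r.
pose U u := phi (rank1 dot u e0) xi.
have Ar u : DX u -> A (rank1 dot u e0) by move=> hu; exact: (A_rank1 hA hu De0).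
have Udom u : DX u -> DY (U u).
  by move=> /Ar /phi_in hu; exact: (D_stable hB hu Dxi).
have Uadd u v : DX u -> DX v -> U (u + v) = U u + U v.
  by move=> hu hv; rewrite /U rank1D phiD; auto.
have Uscale c u : DX u -> U (c *: u) = c *: U u.
  by move=> hu; rewrite /U rank1Z phiZ; auto.
have Uint T u : A T -> DX u -> phi T (U u) = U (T u).
  move=> hT hu; rewrite /U -phiM; auto.
  by rewrite (comp_rank1 dot _ _ (A_bounded hA hT).1).
have Udot u v : DX u -> DX v -> l2dot dot (U u) (U v) = l2dot dot u v.
  move=> hu hv; rewrite /U.
  have Av : A (rank1 dot e0 v) := A_rank1 hA De0 hv.
  rewrite -(phi_adj _ _ Av (Ar v hv) (rank1_adjoint hdot e0 v)).
  rewrite -phiM; auto.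
  by rewrite (rank1_comp hdot) phiZ; auto; rewrite pxi (ipZl hLY) xi1 mulr1.
have Usurj v : exists u, DY v -> DX u /\ U u = v.
  have [hv|] := pselect (DY v); last by exists 0.
  have [S AS phiS] := phi_surj (A_rank1 hB hv Dxi).
  exists (S e0) => _; split; first exact: (D_stable hA AS De0).
  by rewrite -Uint// /U pxi phiS /rank1 xi1 scale1r.
have [V hV] := choice Usurj.
have Uinj u v : DX u -> DX v -> U u = U v -> u = v.
  move=> hu hv huv; have hv' := D_scale hA (-1) hv.
  have huv' := D_add hA hu hv'.
  apply/eqP; rewrite -subr_eq0; apply/eqP; apply: l2norm_eq0.
  apply/eqP; rewrite -(@eqrXn2 _ 2) ?l2norm_ge0// expr0n /=.
  rewrite -(scaleN1r v) (nrm_sqr hLX) -Udot// Uadd// Uscale// huv scaleN1r subrr.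
  by rewrite (ip0l hLY).
exists U, V; split=> //.
- by move=> v hv; have [] := hV v hv.
- by move=> u hu; have [? ?] := hV _ (Udom u hu); exact: Uinj.
- by move=> v hv; have [] := hV v hv.
- by move=> T hT; exists (phi T) => [|u hu]; [exact: phi_in|exact: Uint].
- move=> S hS; have [T hT <-] := phi_surj hS; exists T => // v hv.
  have [DV UV] := hV v hv.
  have DTV : DX (T (V v)) := D_stable hA hT DV.
  have [DVT UVT] := hV _ (Udom _ DTV).
  rewrite -{2}UV Uint//; exact/esym/Uinj.
Qed.

End Implementation.

(** * The two stable uniform Roe algebras *)

Section FiniteDimensional.
Variables (R : realType) (H : normedModType R[i]) (dot : {dot H for Num.conj}).
Hypothesis hdot : norm_of_dot dot.

Let hH := dot_prehilbert hdot.

Definition lin_closed (V : set H) : Prop :=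
  V 0 /\ forall c u v, V u -> V v -> V (c *: u + v).

Lemma lin_span_closed n (e : 'I_n -> H) : lin_closed (lin_span e).
Proof.
split; first by exists (fun=> 0) => //; rewrite big1// => k _; rewrite scale0r.
move=> c _ _ [a _ <-] [b _ <-]; exists (fun k => c * a k + b k) => //.
rewrite scaler_sumr -big_split; apply: eq_bigr => k _.
by rewrite scalerDl scalerA.
Qed.

Lemma lin_span_gen n (e : 'I_n -> H) k : lin_span e (e k).
Proof.
exists (fun j => (j == k)%:R) => //.
rewrite (bigD1 k)//= eqxx scale1r big1 ?addr0// => j /negbTE ->.
by rewrite scale0r.
Qed.

Lemma lin_closed_finite_dim (t : seq H) : exists2 V : set H, finite_dim V &
  lin_closed V /\ {in t, forall a, V a}.
Proof.
pose e (k : 'I_(size t)) := nth 0 t k.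
exists (lin_span e); first by exists (size t), e.
split=> [|a at_]; first exact: lin_span_closed.
have it : (index a t < size t)%N by rewrite index_mem.
have -> : a = e (Ordinal it) by rewrite /e /= nth_index.
exact: lin_span_gen.
Qed.

Lemma operators_on_rank1 (V : set H) a b : lin_closed V -> V a -> V b ->
  operators_on dot V (fun c => dot c b *: a).
Proof.
move=> [V0 Vlin] Va Vb; split=> [c _|c hc]; last by rewrite hc// scale0r.
by rewrite -[_ *: a]addr0; apply: Vlin.
Qed.

Lemma operators_on0 (V : set H) : lin_closed V -> operators_on dot V (fun=> 0).
Proof. by move=> [V0 _]; split. Qed.

(** Elements of [B(V)] take values in [V] on the whole space. *)
Lemma operators_on_proj (V : set H) : finite_dim V ->
  exists2 s, orthonormal_list dot s & forall T : H -> H, linear T ->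
    operators_on dot V T -> forall a, orthoproj dot s (T a) = T a.
Proof.
move=> [n [e ->]].
have [s [hs se sV]] := gram_schmidt hH (codom e) (@rnorm_eq0 R H).
have [V0 Vlin] := lin_span_closed e.
have sV' : {in s, forall a, lin_span e a}.
  apply: sV => // a /codomP[k ->]; exact: lin_span_gen.
have Vproj v : lin_span e v -> orthoproj dot s v = v.
  move=> [a _ <-]; elim/big_rec: _ => [|k w _ IH].
    by rewrite -(scale0r (0 : H)) (projZ hH) !scale0r.
  by rewrite (projD hH) (projZ hH) IH se// codom_f.
exists s => // T linT [TV TVo] a; apply: (Vproj (T a)).
rewrite -(subrK (orthoproj dot s a) a) (linear_mapD linT) TVo ?add0r => [|w Vw].
  by apply: TV; apply: proj_in.
by rewrite -(Vproj w Vw) (ip_sub_proj hH).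
Qed.

End FiniteDimensional.

Section BoundedOperators.
Variables (R : realType) (X : choiceType) (H : normedModType R[i]).
Variable dot : {dot H for Num.conj}.
Hypothesis hdot : norm_of_dot dot.
Implicit Types (u v w : l2 X H) (S T : l2 X H -> l2 X H).

Let hL := @l2_prehilbert R X H dot hdot.

Lemma bounded_restr M T : bounded_operator T ->
  bounded_operator (fun u => restr M (T u)).
Proof.
move=> [linT [C [C0 hC]]]; split; first by move=> c u v; rewrite linT restrD restrZ.
by exists C; split=> // u; apply: le_trans (restr_le _ _) (hC u).
Qed.

Lemma bounded_sub S T : bounded_operator S -> bounded_operator T ->
  bounded_operator (S \- T)%R.
Proof.
move=> [linS [C [C0 hC]]] [linT [D [D0 hD]]]; split.
  move=> c u v /=; rewrite linS linT scalerBr opprD addrACA.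
  by congr (_ + _); rewrite scalerN.
exists (C + D); split; first exact: addr_ge0.
move=> u /=; rewrite mulrDl.
exact: le_trans (nrmB hL _ _) (lerD (hC u) (hD u)).
Qed.

Lemma bounded_sub_proj s T : orthonormal_list dot s -> bounded_operator T ->
  bounded_operator (fun u => T u - projl2 dot s (T u)).
Proof.
move=> hs [linT [C [C0 hC]]]; split.
  move=> c u v; rewrite linT (projl2D hdot hs) (projl2Z hdot hs).
  by rewrite opprD addrACA scalerBr.
by exists C; split=> // u; apply: le_trans (sub_projl2_le hdot hs _) (hC u).
Qed.

Lemma sub_projl2_approx s u v : orthonormal_list dot s ->
  l2norm (u - projl2 dot s u) <= l2norm (u - v) + l2norm (v - projl2 dot s v).
Proof.
move=> hs; rewrite -{1 2}(subrK v u) (sub_projl2D hdot hs).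
rewrite (le_trans (nrmD hL _ _))// lerD2r.
exact: sub_projl2_le.
Qed.

Lemma linear_coef T y x : linear T -> linear (coef T x y).
Proof.
move=> linT c a b; rewrite /coef.
have -> : single y (c *: a + b) = c *: single y a + single y b.
  by apply: l2_ext => z; rewrite l2DE l2ZE !singleE; case: ifP;
    rewrite ?scaler0 ?addr0.
by rewrite linT l2DE l2ZE.
Qed.

Lemma l2_finite_sum u (F : {fset X}) : (forall x, x \notin F -> u x = 0) ->
  u = \sum_(x <- F) single x (u x).
Proof.
move=> uF; rewrite -restr_fset; apply: l2_ext => x; rewrite restrE.
by case: ifPn => //; rewrite notin_setE /= => /negP /uF.
Qed.

Lemma rank1_near u v u' v' w :
  l2norm (rank1 dot u v w - rank1 dot u' v' w) <=
  (l2norm u * l2norm (v - v') + l2norm (u - u') * l2norm v') * l2norm w.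
Proof.
have -> : rank1 dot u v w - rank1 dot u' v' w =
    rank1 dot u (v - v') w + rank1 dot (u - u') v' w.
  by rewrite /rank1 (ipBr hL) scalerBl scalerBr addrA subrK.
apply: le_trans (nrmD hL _ _) _; rewrite mulrDl /rank1 !(nrmZ hL).
by apply: lerD; rewrite mulrC -mulrA ler_wpM2l ?l2norm_ge0// mulrC
  (cauchy_schwarz hL).
Qed.

Lemma restr_near u (e : R) : 0 < e ->
  exists F : {fset X}, l2norm (u - restr [set` F] u) <= e.
Proof.
move=> e0; have [F hF] := restr_tail hdot u e0; exists F.
by rewrite {1}(restr_split [set` F] u) addrC addKr.
Qed.

Lemma opnorm_lt T (e : R) : opnorm_ub T !=set0 -> opnorm T < e ->
  forall u, l2norm (T u) <= e * l2norm u.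
Proof.
move=> T0 /(inf_lt T0)[c [c0 hc] ce] u.
by rewrite (le_trans (hc u))// ler_wpM2r ?l2norm_ge0// ltW.
Qed.

Lemma opnorm_le T (c : R) : 0 <= c ->
  (forall u, l2norm (T u) <= c * l2norm u) -> opnorm T <= c.
Proof. by move=> c0 hc; apply: ge_inf; [exists 0 => d []|split]. Qed.

Definition finitely_supported u : Prop :=
  exists F : {fset X}, forall x, x \notin F -> u x = 0.

Lemma finitely_supported_single y a : finitely_supported (single y a).
Proof.
by exists [fset y]%fset => x; rewrite in_fset1 singleE => /negbTE ->.
Qed.

Lemma finitely_supported0 : finitely_supported 0.
Proof. by exists fset0. Qed.

Lemma finitely_supportedD u v :
  finitely_supported u -> finitely_supported v -> finitely_supported (u + v).
Proof.
move=> [F uF] [G vG]; exists (F `|` G)%fset => x.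
by rewrite in_fsetU negb_or l2DE => /andP[/uF -> /vG ->]; rewrite addr0.
Qed.

Lemma finitely_supportedZ c u :
  finitely_supported u -> finitely_supported (c *: u).
Proof. by move=> [F uF]; exists F => x /uF; rewrite l2ZE => ->; rewrite scaler0. Qed.

Lemma finitely_supported_sum (I : Type) (r : seq I) (G : I -> l2 X H) :
  (forall i, finitely_supported (G i)) ->
  finitely_supported (\sum_(i <- r) G i).
Proof.
move=> hG; elim/big_rec: _ => [|i u _ hu]; first exact: finitely_supported0.
exact: finitely_supportedD.
Qed.

Lemma finitely_supported_restr (F : {fset X}) u :
  finitely_supported (restr [set` F] u).
Proof.
by exists F => x xF; rewrite restrE ifF//; apply/negbTE; rewrite notin_setE/=;
  apply/negP.
Qed.

End BoundedOperators.

Section RoeAlgebras.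
Variables (R : realType) (H : normedModType R[i]) (dot : {dot H for Num.conj}).
Hypothesis hdot : norm_of_dot dot.
Variable X : metricType R.
Hypothesis hX : bounded_geometry X.
Implicit Types (u v w : l2 X H) (S T : l2 X H -> l2 X H).

Let hH := dot_prehilbert hdot.
Let hL := @l2_prehilbert R X H dot hdot.

Lemma Cs_alg_rank1 u v : finitely_supported u -> finitely_supported v ->
  Cs_alg X dot (rank1 dot u v).
Proof.
move=> [F uF] [G vG].
have coef_rank1 x y : coef (rank1 dot u v) x y = fun a => dot a (v y) *: u x.
  by apply/funext => a; rewrite /coef /rank1 l2ZE (l2dot_singlel hdot).
split; first exact: rank1_bounded.
- pose s := \sum_(x <- F) \sum_(y <- G) mdist x y + 1.
  have sum0 (A B : {fset X}) : 0 <= \sum_(x <- A) \sum_(y <- B) mdist x y.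
    by apply: sumr_ge0 => x _; apply: sumr_ge0 => y _; exact: mdist_ge0.
  exists s; first by rewrite ltr_wpDl.
  move=> x y sxy; rewrite coef_rank1; apply/funext => a /=.
  have [xF|/uF ->] := boolP (x \in F); last by rewrite scaler0.
  have [yG|/vG ->] := boolP (y \in G); last by rewrite (ip0r hH) scale0r.
  suff : mdist x y < s by rewrite ltNge sxy.
  rewrite /s (big_fsetD1 x xF) /= (big_fsetD1 y yG) /=.
  rewrite -!addrA ltrDl !addrA ltr_wpDl// addr_ge0//.
  by apply: sumr_ge0 => z _; exact: mdist_ge0.
- have [V fV [Vl Vt]] := lin_closed_finite_dim
    ([seq u x | x <- F] ++ [seq v y | y <- G]).
  exists V => // x y; rewrite coef_rank1.
  have [xF|/uF ->] := boolP (x \in F); last first.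
    by under eq_fun do rewrite scaler0; exact: operators_on0.
  have [yG|/vG ->] := boolP (y \in G); last first.
    by under eq_fun do rewrite (ip0r hH) scale0r; exact: operators_on0.
  apply: operators_on_rank1 => //; apply: Vt; rewrite mem_cat.
    by rewrite map_f.
  by rewrite map_f ?orbT.
Qed.

Lemma Cs_alg_trans tau r a b M : (forall x, mdist x (tau x) <= r) ->
  Cs_alg X dot (fun u => restr M (trans dot tau a b u)).
Proof.
move=> htau.
have coef_trans x y : coef (fun u => restr M (trans dot tau a b u)) x y =
    if (x \in M) && (tau x == y) then fun c => dot c b *: a else fun=> 0.
  apply/funext => c; rewrite /coef restrE (transE hdot hX htau) singleE.
  case: (x \in M) => //=; case: (tau x == y) => //.
  by rewrite (ip0l hH) scale0r.
split.
- exact: bounded_restr (trans_bounded hdot hX htau a b).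
- exists (`|r| + 1); first by rewrite ltr_wpDl.
  move=> x y rxy; rewrite coef_trans; case: ifP => // /andP[_ /eqP txy].
  move: rxy; rewrite -txy leNgt => /negP; case.
  by rewrite (le_lt_trans (htau x))// (le_lt_trans (ler_norm r))// ltrDl.
- have [V fV [Vl Vt]] := lin_closed_finite_dim [:: a; b].
  exists V => // x y; rewrite coef_trans; case: ifP => _.
    by apply: operators_on_rank1 => //; apply: Vt; rewrite !inE eqxx ?orbT.
  exact: operators_on0.
Qed.

Lemma Cs_alg_propagation T : Cs_alg X dot T ->
  exists s, forall x a, restr (~` cball x s) (T (single x a)) = 0.
Proof.
move=> [_ [s s0 hs] _]; exists s => x a; apply: l2_ext => y; rewrite restrE.
case: ifPn => // /set_mem /= /negP; rewrite -ltNge => sxy.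
have := congr1 (fun f => f a) (hs y x _); apply; rewrite metric_sym; exact: ltW.
Qed.

(** The coefficients take values in a fixed finite dimensional space, hence so
    do the values of [T] on finitely supported functions, and by continuity on
    all functions. *)
Lemma Cs_alg_finite_rank T : Cs_alg X dot T ->
  exists2 s, orthonormal_list dot s & forall u, T u - projl2 dot s (T u) = 0.
Proof.
move=> [bT _ [V fV hV]]; have [s hs sV] := operators_on_proj hdot fV.
exists s => // u.
apply: (bounded_ext0 hdot (bounded_sub_proj hdot hs bT)) => y a.
apply: l2_ext => x; rewrite (l2BE (T _)) (projl2E hdot _ x hs).
by have := sV _ (linear_coef y x bT.1) (hV x y) a; rewrite /coef => ->; rewrite subrr.
Qed.

Lemma Cs_alg_support T u : Cs_alg X dot T -> finitely_supported u ->
  finitely_supported (T u).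
Proof.
move=> hT [F uF]; rewrite (l2_finite_sum uF); have [bT _ _] := hT.
rewrite (linear_map_sum bT.1); apply: finitely_supported_sum => x.
have [s hs] := Cs_alg_propagation hT.
have [N hN] := cball_fset hX s; have [B hB _] := hN x; exists B => y yB.
have := congr1 (fun w : l2 X H => w y) (hs x (u x)).
rewrite /= restrE ifT//; apply/mem_set; rewrite -hB /=; exact/negP.
Qed.

Lemma Cs_alg_roe_like : roe_like dot (Cs_alg X dot) (@finitely_supported R X H).
Proof.
split.
- exact: finitely_supported_single.
- exact: finitely_supported0.
- exact: finitely_supportedD.
- by move=> c u; exact: finitely_supportedZ.
- by move=> T u; exact: Cs_alg_support.
- exact: Cs_alg_rank1.
- exact: Cs_alg_trans.
- by move=> T [].
- move=> T eps hT eps0; have [s hs] := Cs_alg_propagation hT; exists s => x a.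
  by rewrite hs (nrm0 hL) mulr_ge0 ?rnorm_ge0// ltW.
- move=> T eps hT eps0; have [s hs sT] := Cs_alg_finite_rank hT.
  by exists s => // u; rewrite sT (nrm0 hL) mulr_ge0 ?l2norm_ge0// ltW.
Qed.

(** Membership in the norm closure is used in this form: this lemma and its
    converse replace the operator norm, an infimum, by an inequality for all
    vectors. *)
Lemma Cs_star_approx T (e : R) : Cs_star X dot T -> 0 < e ->
  exists2 S, Cs_alg X dot S & forall u, l2norm (T u - S u) <= e * l2norm u.
Proof.
move=> [bT hT] /hT[S hS hTS]; exists S => //; have [bS _ _] := hS.
exact: opnorm_lt (bounded_sub hdot bT bS).2 hTS.
Qed.

Lemma Cs_star_limit T : bounded_operator T ->
  (forall e : R, 0 < e -> exists2 S, Cs_alg X dot S &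
    forall u, l2norm (T u - S u) <= e * l2norm u) ->
  Cs_star X dot T.
Proof.
move=> bT h; split=> // e e0.
have e2 : 0 < e / 2 by rewrite divr_gt0.
have [S hS hTS] := h _ e2; exists S => //.
rewrite (@le_lt_trans _ _ (e / 2))//; last by rewrite ltr_pdivrMr// ltr_pMr// ltr1n.
by apply: opnorm_le => //; exact: ltW.
Qed.

Lemma Cs_star_roe_like : roe_like dot (Cs_star X dot) setT.
Proof.
split=> //.
- move=> u v _ _; apply: Cs_star_limit; first exact: rank1_bounded.
  move=> e e0; pose K := l2norm u + l2norm v + 1.
  have K0 : 0 < K by rewrite ltr_wpDl// addr_ge0 ?l2norm_ge0.
  have [F hF] := restr_near hdot u (divr_gt0 e0 K0).
  have [G hG] := restr_near hdot v (divr_gt0 e0 K0).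
  exists (rank1 dot (restr [set` F] u) (restr [set` G] v)).
    by apply: Cs_alg_rank1; exact: finitely_supported_restr.
  move=> w; apply: (le_trans (rank1_near hdot _ _ _ _ _)).
  rewrite ler_wpM2r ?l2norm_ge0//.
  apply: le_trans (lerD (ler_wpM2l (l2norm_ge0 u) hG)
    (ler_pM (l2norm_ge0 _) (l2norm_ge0 _) hF (restr_le [set` G] v))) _.
  rewrite mulrC -mulrDr mulrAC ler_pdivrMr// ler_wpM2l ?(ltW e0)//.
  by rewrite /K lerDl.
- move=> tau r a b M htau; have hS := Cs_alg_trans a b M htau.
  have [bS _ _] := hS; apply: Cs_star_limit => // e e0; eexists; first exact: hS.
  by move=> u; rewrite subrr (nrm0 hL) mulr_ge0 ?l2norm_ge0// ltW.
- by move=> T [].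
- move=> T eps hT eps0; have [S hS hTS] := Cs_star_approx hT eps0.
  have [s hs] := Cs_alg_propagation hS; exists s => x a.
  apply: le_trans (restr_sub_le hdot _ _ (S (single x a))) _.
  rewrite hs (nrm0 hL) add0r; apply: le_trans (hTS _) _.
  by rewrite (l2norm_single hdot).
- move=> T eps hT eps0; have [S hS hTS] := Cs_star_approx hT eps0.
  have [s hs sS] := Cs_alg_finite_rank hS; exists s => // u.
  apply: le_trans (sub_projl2_approx hdot _ (S u) hs) _.
  by rewrite sS (nrm0 hL) addr0.
Qed.

End RoeAlgebras.

(** * Rigidity *)

Section Rigidity.
Variables (R : realType) (H : normedModType R[i]) (dot : {dot H for Num.conj}).
Hypothesis hdot : norm_of_dot dot.

Lemma unit_vector : ~ finite_dim [set: H] -> exists h : H, rnorm h = 1.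
Proof.
move=> hinf; apply: contrapT => none; apply: hinf.
exists 0%N, (fun=> 0); apply/seteqP; split=> v // _; exists (fun=> 0) => //.
rewrite big_ord0; apply: contrapT => v0; apply: none.
have nv : rnorm v != 0 by apply/eqP => /rnorm_eq0 /esym.
exists ((rnorm v)^-1%:C *: v).
by rewrite rnormZ -/(cmod _) cmod_real ?invr_ge0 ?rnorm_ge0// mulVf.
Qed.

Lemma rank1_single_neq0 (X : choiceType) (x : X) (h : H) : rnorm h = 1 ->
  rank1 dot (single x h) (single x h) <> (fun=> 0).
Proof.
move=> h1 /(congr1 (fun T => l2norm (T (single x h)))).
have hL := @l2_prehilbert R X H dot hdot.
rewrite (nrm0 hL) /rank1 (nrmZ hL) (ipE hL) (l2norm_single hdot) h1 expr1n.
by rewrite cmod1 mulr1 => /eqP; rewrite oner_eq0.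
Qed.

(** The implementing isometry needs a base point in [X].  If [X] is empty there
    is only one operator on [l2 X H], while [l2 Y H] carries a nonzero one as
    soon as [Y] has a point. *)
Lemma isomorphism_coarsely_equivalent (X Y : metricType R)
    (A : set (l2 X H -> l2 X H)) DX (B : set (l2 Y H -> l2 Y H)) DY phi (h : H) :
  bounded_geometry X -> bounded_geometry Y ->
  roe_like dot A DX -> roe_like dot B DY -> rnorm h = 1 ->
  star_isomorphism dot A B phi -> coarsely_equivalent X Y.
Proof.
move=> hX hY hA hB h1 hphi.
have [[x0 _]|nX] := pselect (exists x : X, True).
  have [U [V hU]] := isomorphism_spatial hdot hA hB hphi x0 h1.
  exact: (spatial_coarsely_equivalent hdot hX hY hA hB hU h1).
have [[y0 _]|nY] := pselect (exists y : Y, True); last first.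
  have f (x : X) : Y by exfalso; apply: nX; exists x.
  have g (y : Y) : X by exfalso; apply: nY; exists y.
  exists f, g; split.
  - by move=> r r0; exists 1 => // x; exfalso; apply: nX; exists x.
  - by move=> r r0; exists 1 => // y; exfalso; apply: nY; exists y.
  - by exists 1 => // y; exfalso; apply: nY; exists y.
  - by exists 1 => // x; exfalso; apply: nX; exists x.
exfalso; have Dy := D_single hB y0 h.
have [S AS phiS] := phi_surj hphi (A_rank1 hB Dy Dy).
have XE (u v : l2 X H) : u = v.
  by apply: l2_ext => x; exfalso; apply: nX; exists x.
have := @rank1_single_neq0 Y y0 h h1; apply; rewrite -phiS; apply/funext => u.
have := phiZ hphi 0 u AS; have -> : (0 \*: S)%R = S by apply/funext => v; exact: XE.
by rewrite (scale0r (phi S u)).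
Qed.

End Rigidity.

Theorem theorem6p1 (R : realType) (H : completeNormedModType R[i])
    (dot : {dot H for Num.conj}) (hdot : norm_of_dot dot)
    (hsep : separable_space H) (hinf : ~ finite_dim [set: H])
    (X Y : metricType R)
    (hX : bounded_geometry X) (hY : bounded_geometry Y) :
  (property_A X -> property_A Y ->
    (exists phi, star_isomorphism dot (Cs_star X dot) (Cs_star Y dot) phi) ->
    coarsely_equivalent X Y)
  /\
  ((exists phi, star_isomorphism dot (Cs_alg X dot) (Cs_alg Y dot) phi) ->
    coarsely_equivalent X Y).
Proof.
have [h h1] := unit_vector hinf.
split=> [_ _|] [phi hphi].
- exact: (isomorphism_coarsely_equivalent hdot hX hY
    (Cs_star_roe_like hdot hX) (Cs_star_roe_like hdot hY) h1 hphi).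
- exact: (isomorphism_coarsely_equivalent hdot hX hY
    (Cs_alg_roe_like hdot hX) (Cs_alg_roe_like hdot hY) h1 hphi).
Qed.
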